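(* Let $B_n$ be endowed with the dual Garside structure, let $n=rd+1$ for integers $r\geqslant 2$ and $d\geqslant 1$, and let $\varepsilon=\delta a_{21}$. Then the cardinality of the super summit set $[\varepsilon^d]^S$ is $$nZ_d(r)=\frac{n}{d}\binom{dr}{d-1}=\frac{n}{d}\binom{n-1}{d-1},$$ where $Z_d(r)$ is the number of multichains $1\preccurlyeq a_1\preccurlyeq\cdots\preccurlyeq a_{r-1}\preccurlyeq[d,d-1,\ldots,1]$ of simple elements.
   Context: $B_n$ has band generators $a_{ij}$ ($1\le j<i\le n$), $a_{ij}=\sigma_{i-1}\cdots\sigma_{j+1}\sigma_j\sigma_{j+1}^{-1}\cdots\sigma_{i-1}^{-1}$. The dual Garside structure is $(B_n,B_n^+,\delta)$ with $B_n^+$ the monoid of positive words in band generators and $\delta=a_{n,n-1}\cdots a_{21}=\sigma_{n-1}\cdots\sigma_1$. $\alpha\preccurlyeq\beta$ iff $\alpha^{-1}\beta\in B_n^+$; simple elements are those $\alpha$ with $1\preccurlyeq\alpha\preccurlyeq\delta$. $\inf(\alpha)=\max\{r:\delta^r\preccurlyeq\alpha\}$, $\sup(\alpha)=\min\{s:\alpha\preccurlyeq\delta^s\}$, $\operatorname{len}=\sup-\inf$, and the super summit set $[\alpha]^S$ is the set of conjugates of $\alpha$ of minimal $\operatorname{len}$. For $1\le i_1<\cdots<i_k\le n$, $[i_k,\ldots,i_1]=a_{i_ki_{k-1}}\cdots a_{i_2i_1}$. *)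

(* Defs.v *)
(* Braid group B_n presented by Artin generators; elements are
   represented by words, with equality the braid-group congruence [beq n]. *)
From mathcomp Require Import all_boot all_order all_algebra.
Set Implicit Arguments. Unset Strict Implicit. Unset Printing Implicit Defensive.
Import Order.TTheory GRing.Theory Num.Theory.

(* A letter (k, true) is sigma_k, (k, false) is sigma_k^{-1}. *)
Definition letter := (nat * bool)%type.
Definition word := seq letter.

Definition valid (n : nat) (w : word) : bool := all (fun l => (0 < l.1 < n)%N) w.

Inductive beq (n : nat) : word -> word -> Prop :=
| beq_refl w : beq n w w
| beq_sym u v : beq n u v -> beq n v u
| beq_trans u v w : beq n u v -> beq n v w -> beq n u w
| beq_ctx x u v y : beq n u v -> beq n (x ++ u ++ y) (x ++ v ++ y)
| beq_free i b : (0 < i < n)%N -> beq n [:: (i, b); (i, ~~ b)] [::]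
| beq_comm i j : (0 < i < n)%N -> (0 < j < n)%N -> (i.+1 < j)%N ->
    beq n [:: (i, true); (j, true)] [:: (j, true); (i, true)]
| beq_braid i : (0 < i)%N -> (i.+1 < n)%N ->
    beq n [:: (i, true); (i.+1, true); (i, true)]
          [:: (i.+1, true); (i, true); (i.+1, true)].

Definition winv (w : word) : word := rev (map (fun l => (l.1, ~~ l.2)) w).

Definition wpow (w : word) (r : int) : word :=
  match r with
  | Posz k => flatten (nseq k w)
  | Negz k => flatten (nseq k.+1 (winv w))
  end.

(* band generator a_{ij} = s_{i-1}..s_{j+1} s_j s_{j+1}^{-1}..s_{i-1}^{-1}, 1<=j<i<=n *)
Definition band (i j : nat) : word :=
  map (fun k => (k, true)) (rev (iota j.+1 (i - j.+1)))
  ++ [:: (j, true)] ++ map (fun k => (k, false)) (iota j.+1 (i - j.+1)).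

(* delta = a_{n,n-1} ... a_{21} = sigma_{n-1} ... sigma_1 *)
Definition delta (n : nat) : word := map (fun k => (k, true)) (rev (iota 1 n.-1)).

Definition positive (n : nat) (a : word) : Prop :=
  exists ps : seq (nat * nat),
    all (fun p => (0 < p.2 < p.1)%N && (p.1 <= n)%N) ps /\
    beq n (flatten (map (fun p => band p.1 p.2) ps)) a.

Definition prec (n : nat) (a b : word) : Prop := positive n (winv a ++ b).

Definition simple (n : nat) (a : word) : Prop := prec n [::] a /\ prec n a (delta n).

Definition is_inf (n : nat) (a : word) (r : int) : Prop :=
  prec n (wpow (delta n) r) a /\ forall r', prec n (wpow (delta n) r') a -> (r' <= r)%R.
Definition is_sup (n : nat) (a : word) (s : int) : Prop :=
  prec n a (wpow (delta n) s) /\ forall s', prec n a (wpow (delta n) s') -> (s <= s')%R.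
Definition has_len (n : nat) (a : word) (l : int) : Prop :=
  exists r s, is_inf n a r /\ is_sup n a s /\ l = (s - r)%R.

Definition conj_to (n : nat) (a b : word) : Prop :=
  exists x, valid n x /\ beq n b (winv x ++ a ++ x).

Definition SSS (n : nat) (a : word) (b : word) : Prop :=
  valid n b /\ conj_to n a b /\
  exists l, has_len n b l /\
    forall c l', valid n c -> conj_to n a c -> has_len n c l' -> (l <= l')%R.

Definition card_mod (T : eqType) (E : T -> T -> Prop) (P : T -> Prop) (N : nat) : Prop :=
  exists ws : seq T,
    size ws = N /\ (forall w, w \in ws -> P w) /\
    (forall i j x, (i < size ws)%N -> (j < size ws)%N -> i <> j ->
        ~ E (nth x ws i) (nth x ws j)) /\
    (forall w, P w -> exists2 w', w' \in ws & E w w').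

Definition seq_beq (n : nat) (s t : seq word) : Prop :=
  size s = size t /\ forall k, (k < size s)%N -> beq n (nth [::] s k) (nth [::] t k).

(* [i_k, ..., i_1] = a_{i_k i_{k-1}} ... a_{i_2 i_1}; here [d, d-1, ..., 1] *)
Definition down_chain (d : nat) : word :=
  flatten (map (fun k => band k.+1 k) (rev (iota 1 d.-1))).

Definition multichain (n m : nat) (top : word) (s : seq word) : Prop :=
  size s = m /\ all (valid n) s /\ (forall k, (k < m)%N -> simple n (nth [::] s k)) /\
  (let c := [::] :: rcons s top in
   forall k, (k <= m)%N -> prec n (nth [::] c k) (nth [::] c k.+1)).

Definition epsilon (n : nat) : word := delta n ++ band 2 1.

(* Main.v *)
From HB Require Import structures.
Require Import Defs.
From mathcomp Require Import all_boot all_order all_algebra.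
From mathcomp Require Import all_fingroup generic_quotient boolp zify ring.
Set Implicit Arguments. Unset Strict Implicit. Unset Printing Implicit Defensive.
Import Order.TTheory.

(** Write n = rd + 1, let c be the n-cycle that is the image of delta in the symmetric group, and
let len be the absolute (reflection) length. Simple elements correspond to the permutations w
dividing c, i.e. len w + len (w^-1 c) = len c; the dual_lift of w is well defined because any two reduced
words of band generators for w are related by the band relations (move the letters containing the
largest point to the front and merge them).

Comparing exponent sums, the super summit set of epsilon^d consists of its conjugates of the form
delta^d s with s simple of length d, and the image w of s satisfies (c^d w)^r = 1. Then the product of
the translates of w by (r-1)d, ..., d, 0 is a reduced factorization of c. Noncrossingness forces
every step of c^d w to turn by at most 2d, and summing the turns over Z/n shows that c^d w has
a fixed point. Rotating it to 0, w preserves the windows [0,d], (d,2d], ..., ((r-1)d,rd], and the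
restrictions of w, moved to a common window, are exactly the reduced factorizations of a d-cycle
into r factors, i.e. the multichains. Such a delta^d s is conjugated to epsilon^d by merging each
window into the preceding one. The n possible fixed points give the factor n.

For d Z_d(r) = C(rd, d-1), factorizations of a cycle are split according to the image of a point
under the first factor that moves it, which gives the recursion of r-ary trees; the numbers
f(a,m) of forests of a such trees with m nodes satisfy f(a+1,m) = f(a,m) + f(a+r,m-1), hence
(a + rm) f(a,m) = a C(a + rm, m). *)

(** * Fuss-Catalan numbers *)

Section FussCatalan.
Variables (r M : nat) (z : nat -> nat) (A : nat -> nat -> nat).
Hypothesis r_gt0 : 0 < r.
Hypothesis z0 : z 0 = 1%N.
Hypothesis A0 : forall m, m <= M -> A 0 m = (m == 0).
Hypothesis AS : forall k m, k < r -> m <= M ->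
  A k.+1 m = (\sum_(q < m.+1) A k q * z (m - q))%N.
Hypothesis Ar : forall m, m < M -> A r m = z m.+1.

(** The generating function of [z], cut at degree [M]. Up to that degree the hypotheses say that
    [A k] lists the coefficients of [P ^+ k] and that [P] is 1 plus the variable times [P ^+ r], the
    equation of r-ary trees. *)
Let P : {poly nat} := (\poly_(i < M.+1) z i)%R.

Let PE i : i <= M -> (P`_i)%R = z i.
Proof. by move=> iM; rewrite coef_poly ltnS iM. Qed.

Let f k m : nat := ((polyseq (P ^+ k))`_m)%R.

Let f0 m : f 0 m = (m == 0).
Proof. by rewrite /f GRing.expr0 coef1; case: eqP. Qed.

Let fD k l m : f (k + l) m = (\sum_(i < m.+1) f k i * f l (m - i))%N.
Proof. by rewrite /f GRing.exprD coefM. Qed.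

Let f1 m : m <= M -> f 1 m = z m.
Proof. exact: PE. Qed.

Let fA k m : k <= r -> m <= M -> f k m = A k m.
Proof.
elim: k m => [|k IH] m kr mM; first by rewrite f0 A0.
rewrite -addn1 fD addn1 AS //; apply: eq_bigr => q _.
by have := ltn_ord q => qm; rewrite IH ?f1 //; lia.
Qed.

(** Expand one factor [P]: its constant term leaves [P ^+ a], and the rest is the variable times
    [P ^+ r]. The first tree is empty, or a root with [r] subtrees. *)
Let f_forest a m : m < M -> f a.+1 m.+1 = f a m.+1 + f (a + r) m.
Proof.
move=> mM; rewrite -add1n fD big_ord_recl f1 // z0 mul1n subn0.
congr (_ + _)%N; rewrite addnC fD; apply: eq_bigr => i _.
by have := ltn_ord i => im; rewrite f1 ?(@fA r) ?Ar ?subSS //= ?/bump; lia.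
Qed.

Let forest_count m a : m <= M -> (a + r * m) * f a m = a * 'C(a + r * m, m).
Proof.
elim: m a => [|m IHm] a mM.
  suff -> : f a 0 = 1 by rewrite bin0 muln0 addn0.
  by elim: a => [|a IHa]; rewrite ?f0 // -add1n fD big_ord1 IHa f1 // z0.
elim: a => [|a IHa]; first by rewrite f0 muln0 mul0n.
rewrite f_forest //; have := IHm (a + r) (ltnW mM).
rewrite -addnA -mulnS; move: IHa; rewrite addSn binS.
set n := a + r * m.+1 => Hf Hg.
have n_gt0 : 0 < n by rewrite /n; nia.
have Hb : m.+1 * 'C(n, m.+1) + m * 'C(n, m) = n * 'C(n, m).
  have := mul_bin_left n m; have [mn|nm] := leqP m n; last by rewrite !bin_small //; lia.
  by move=> ->; rewrite -mulnDl subnK.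
(* Both induction hypotheses carry the factor [n]; multiplying the goal by it allows them to be
   substituted. *)
apply/eqP; rewrite -(eqn_pmul2l n_gt0); apply/eqP.
have -> : n * (n.+1 * (f a m.+1 + f (a + r) m)) =
  n.+1 * (n * f a m.+1 + n * f (a + r) m) by nia.
rewrite Hf Hg; have E : n = a + r * m.+1 by [].
have {}Hb : r * (m.+1 * 'C(n, m.+1) + m * 'C(n, m)) = r * (n * 'C(n, m)) by rewrite Hb.
nia.
Qed.

(** Removing the root of a tree with [M] nodes leaves a forest of [r] trees with [M - 1] nodes; the
    common factor [r] in [forest_count] cancels. *)
Lemma fuss_catalan : 0 < M -> M * z M = 'C(r * M, M.-1).
Proof.
move=> M_gt0; have := @forest_count M.-1 r (leq_pred _).
rewrite fA ?leq_pred // Ar ?prednK // -mulnS prednK // -mulnA => /eqP.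
by rewrite eqn_pmul2l // => /eqP.
Qed.

End FussCatalan.

Open Scope group_scope.

(** * Absolute length of permutations *)

(* Elaboration of ['S_n] leaves [reverse_coercion] wrappers, which [lia] takes for distinct atoms. *)
Ltac plia := unfold reverse_coercion in *; lia.
Ltac pnia := unfold reverse_coercion in *; nia.

Section AbsoluteLength.
Variable T : finType.
Implicit Types (s t a b : {perm T}) (P : pred T).

(* Unlike [mulgA], rewriting with this keeps the structure instances that [lia] can match. *)
Lemma mulpA a b s : a * (b * s) = a * b * s. Proof. exact: mulgA. Qed.

(** The number of points minus the number of cycles, fixed points included: the least number of
    transpositions with product [s]. *)
Definition abslen s := #|T| - #|porbits s|.

Definition stable P s := forall x, P x -> P (s x).

Lemma card_porbits_le s : #|porbits s| <= #|T|.
Proof. exact: leq_imset_card. Qed.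

Lemma abslen_tpermL s x y : x != y -> y \in porbit s x ->
  (abslen (tperm x y * s)).+1 = abslen s.
Proof.
move=> xy yx; have := porbits_mul_tperm s x y; rewrite /= porbit_sym yx xy /abslen /= addn0 addn1 => E.
by have := card_porbits_le (tperm x y * s); rewrite E => h; rewrite subnSK.
Qed.

Lemma abslen_tpermL_out s x y : y \notin porbit s x ->
  abslen (tperm x y * s) = (abslen s).+1.
Proof.
move=> yx; have := porbits_mul_tperm s x y; rewrite /= porbit_sym yx /abslen /=.
have -> : x != y by apply: contraNneq yx => <-; exact: porbit_id.
rewrite /= addn2 addn1 => -[E].
by have := card_porbits_le s; rewrite -E => h; rewrite subnSK.
Qed.

Lemma porbit_in s x : s x \in porbit s x.
Proof. exact: (mem_porbit s 1). Qed.

Lemma porbit_fixed s x y : s y = y -> (y \in porbit s x) = (y == x).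
Proof.
move=> sy; rewrite porbit_sym; apply/idP/eqP => [/porbitP[k ->]|->]; last exact: porbit_id.
by elim: k => [|k IH]; rewrite ?expg0 ?perm1 // expgSr permM -IH.
Qed.

Lemma abslen1 : abslen 1 = 0.
Proof.
rewrite /abslen card_imset ?subnn // => x y /setP/(_ x).
by rewrite porbit_id porbit_fixed ?perm1 // => /esym/eqP.
Qed.

Lemma abslen_split a : a != 1 -> exists x, [/\ a x != x, x != a x &
  (abslen (tperm x (a x) * a)).+1 = abslen a].
Proof.
move=> a1; have [x ax] : exists x, a x != x.
  apply/existsP; apply: contraNT a1 => /existsPn H; apply/eqP/permP => x.
  by rewrite perm1; apply/eqP/negPn/H.
by exists x; rewrite ax eq_sym ax abslen_tpermL ?porbit_in // eq_sym.
Qed.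

Lemma abslen_eq0 s : abslen s = 0 -> s = 1.
Proof.
by move=> s0; apply/eqP; apply/negPn/negP => /abslen_split[x [_ _]]; rewrite s0.
Qed.

Lemma abslenJ s t : abslen (s ^ t) = abslen s.
Proof.
suff le (u v : {perm T}) : #|porbits u| <= #|porbits (u ^ v)|.
  rewrite /abslen; congr (_ - _); apply/eqP; rewrite eqn_leq le andbT.
  by rewrite -{2}(conjgK t s) le.
rewrite -(card_imset (porbits u) (imset_inj (@perm_inj _ v))).
apply/subset_leq_card/subsetP => A /imsetP[B /imsetP[x _ ->] ->].
apply/imsetP; exists (v x) => //; apply/setP => y.
apply/imsetP/porbitP => [[z /porbitP[i ->] ->]|[i ->]].
  by exists i; rewrite -conjXg permJ.
by exists ((u ^+ i) x); rewrite ?mem_porbit // -conjXg permJ.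
Qed.

Lemma abslenC a b : abslen (a * b) = abslen (b * a).
Proof. by rewrite -(abslenJ _ a) /conjg !mulpA mulVg mul1g. Qed.

Lemma abslen_tpermJ s x y : abslen (tperm x y * s * tperm x y) = abslen s.
Proof. by rewrite -[RHS](abslenJ s (tperm x y)) /conjg tpermV mulpA. Qed.

Lemma abslen_ind (K : {perm T} -> Prop) : K 1 ->
  (forall x a, a x != x -> (abslen (tperm x (a x) * a)).+1 = abslen a ->
     K (tperm x (a x) * a) -> K a) -> forall a, K a.
Proof.
move=> K1 KS a; move: {2}(abslen a) (erefl (abslen a)) => k.
elim: k a => [|k IH] a la; first by rewrite (abslen_eq0 la).
have [|x [ax _ lx]] := @abslen_split a.
  by apply: contra_eq_neq la => ->; rewrite abslen1.
by apply: (KS x) => //; apply: IH; apply/eqP; rewrite -eqSS lx la.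
Qed.

Lemma abslen_tperm_le s x y : abslen (tperm x y * s) <= (abslen s).+1.
Proof.
have [<-|xy] := eqVneq x y; first by rewrite tperm1 mul1g leqnSn.
have [yx|yx] := boolP (y \in porbit s x); last by rewrite abslen_tpermL_out.
by rewrite -(abslen_tpermL xy yx) ltnW // ltnS.
Qed.

Lemma abslenM_le a b : abslen (a * b) <= abslen a + abslen b.
Proof.
elim/abslen_ind: a => [|x a ax la IH]; first by rewrite mul1g abslen1.
rewrite -la addSn -ltnS.
have -> : a * b = tperm x (a x) * (tperm x (a x) * a * b) by rewrite !mulpA tperm2 mul1g.
by rewrite ltnS (leq_trans (abslen_tperm_le _ _ _)).
Qed.

Lemma abslen_prod_le (I : Type) (r : seq I) (F : I -> {perm T}) :
  abslen (\prod_(i <- r) F i) <= (\sum_(i <- r) abslen (F i))%N.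
Proof.
elim: r => [|i r IH]; rewrite ?big_nil ?abslen1 // !big_cons.
by rewrite (leq_trans (abslenM_le _ _)) // leq_add2l.
Qed.

Lemma stable1 P : stable P 1. Proof. by move=> x; rewrite perm1. Qed.

Lemma stableM P a b : stable P a -> stable P b -> stable P (a * b).
Proof. by move=> Pa Pb x Px; rewrite permM; apply/Pb/Pa. Qed.

Lemma stableX P a k : stable P a -> stable P (a ^+ k).
Proof.
by move=> Pa; elim: k => [|k IH]; [exact: stable1 | rewrite expgS; exact: stableM].
Qed.

Lemma stableV P a : stable P a -> stable P a^-1.
Proof.
move=> Pa; have -> : a^-1 = a ^+ #[a].-1 by rewrite -invg_expg.
exact: stableX.
Qed.

Lemma stableC P a : stable P a -> stable (predC P) a.
Proof.
move=> Pa x /= nPx; apply: contra nPx => Pax.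
by rewrite -(permK a x); exact: stableV.
Qed.

Lemma stable_porbit P a x y : stable P a -> y \in porbit a x -> P x -> P y.
Proof. by move=> Pa /porbitP[k ->]; exact: stableX. Qed.

(* A transposition that lengthens s merges two of its cycles. *)
Lemma stable_tpermL P s x y : abslen (tperm x y * s) = (abslen s).+1 ->
  stable P (tperm x y * s) -> stable P (tperm x y) /\ stable P s.
Proof.
set h := tperm x y * s => lh Ph.
have sE : s = tperm x y * h by rewrite /h mulpA tperm2 mul1g.
have yx : y \in porbit h x.
  by apply/negPn/negP => /abslen_tpermL_out; rewrite -sE lh; lia.
have Pt : stable P (tperm x y).
  move=> z; case: tpermP => [->|->|//]; first exact: stable_porbit yx.
  by apply: (stable_porbit Ph); rewrite porbit_sym.
by split=> //; rewrite sE; exact: stableM.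
Qed.

Definition reduced a b := abslen (a * b) = abslen a + abslen b.

Lemma reduced_prefix a b e : reduced (a * b) e -> reduced a b -> reduced a (b * e) /\ reduced b e.
Proof.
rewrite /reduced !mulpA => h1 h2; have := abslenM_le a (b * e).
by have := abslenM_le b e; rewrite !mulpA; lia.
Qed.

Lemma reducedJ a b g : reduced a b -> reduced (a ^ g) (b ^ g).
Proof. by rewrite /reduced -conjMg !abslenJ. Qed.

Lemma reduced_swap a b : reduced a b -> reduced b (a ^ b).
Proof. by rewrite /reduced /conjg mulpA mulgV mul1g abslenJ addnC. Qed.

(** When [a] is a shortest product of transpositions, multiplying [b] by them one at a time only
    merges cycles; a union of cycles of the final product is a union of cycles at every earlier
    stage. *)
Lemma stable_reduced P a b : reduced a b -> stable P (a * b) -> stable P a /\ stable P b.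
Proof.
suff Pb : reduced a b -> stable P (a * b) -> stable P b.
  move=> ab Pab; have := Pb ab Pab; split=> //.
  by rewrite -(mulgK b a); apply: stableM => //; apply: stableV.
elim/abslen_ind: a => [|x a ax la IH]; first by rewrite mul1g.
set t := tperm x (a x) in la IH *; rewrite /reduced => lab Pab.
have E : a * b = t * (t * a * b) by rewrite !mulpA tperm2 mul1g.
have l1 : abslen (t * a * b) <= abslen (t * a) + abslen b := abslenM_le _ _.
have l2 : abslen (a * b) <= (abslen (t * a * b)).+1 by rewrite E abslen_tperm_le.
apply: IH; first by rewrite /reduced; lia.
have l3 : abslen (t * (t * a * b)) = (abslen (t * a * b)).+1 by rewrite -E; lia.
by rewrite E in Pab; case: (stable_tpermL l3 Pab).
Qed.

(** The transposition peeled off [a] at [x] also shortens [a * b]: [b] fixes [a x], so [a x] is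
    still the image of [x]. *)
Lemma reduced_disjoint P a b : (forall x, a x != x -> P x) ->
  (forall x, b x != x -> ~~ P x) -> reduced a b.
Proof.
move=> + bP; elim/abslen_ind: a => [|x a ax la IH] aP.
  by rewrite /reduced mul1g abslen1.
set t := tperm x (a x) in la IH *.
have Pax : P (a x) by apply: aP; rewrite (inj_eq perm_inj).
have bax : b (a x) = a x by apply/eqP; apply: contraTT Pax => /bP.
have := @abslen_tpermL (a * b) x (a x); rewrite -/t eq_sym ax => /(_ isT).
rewrite (_ : a x \in _); last by rewrite -{1}bax -permM porbit_in.
move=> /(_ isT); rewrite mulpA IH /reduced; first by lia.
move=> z; rewrite permM /t; case: tpermP => [->|->|_ _]; last exact: aP.
  by move=> _; exact: aP.
by rewrite Pax.
Qed.

Lemma mul_tpermK a b x y (t := tperm x y) : a * t * (t * b * t) = a * b * t.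
Proof. by rewrite !mulpA -(mulpA a) tperm2 mulg1. Qed.

End AbsoluteLength.

(** * Cycles on intervals and noncrossing permutations *)

Section IntervalCycles.
Variable N : nat.
Notation n := N.+1.
Implicit Types (x y : 'I_n) (a b : nat) (p q : 'S_n).

(** The cycle through [a], ..., [b] in increasing order. It is the identity for bounds out of order
    or out of range, so that [cyc] is a permutation for all arguments. *)
Definition cyc_fun a b (x : 'I_n) : 'I_n :=
  if a <= b <= N then
    if a <= x < b then inord x.+1 else if x == b :> nat then inord a else x
  else x.

Lemma cyc_funE a b x : a <= b <= N -> val (cyc_fun a b x) =
  if a <= x < b then x.+1 else if x == b :> nat then a else x.
Proof.
move=> ab; rewrite /cyc_fun ab; case: ifP => h; first by rewrite /= inordK; lia.
by case: eqP => // _; rewrite /= inordK; lia.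
Qed.

Lemma cyc_fun_inj a b : injective (cyc_fun a b).
Proof.
move=> x y; have [ab|/negPf ab] := boolP (a <= b <= N); last by rewrite /cyc_fun ab.
move=> /(congr1 val); rewrite !cyc_funE // => E; apply: val_inj => /=; move: E.
by do ?case: ifP; lia.
Qed.

Definition cyc a b : 'S_n := perm (@cyc_fun_inj a b).

Lemma cycE a b x : a <= b <= N -> val (cyc a b x) =
  if a <= x < b then x.+1 else if x == b :> nat then a else x.
Proof. by move=> ab; rewrite permE cyc_funE. Qed.

Lemma cyc_out a b x : ~~ (a <= x <= b) -> cyc a b x = x.
Proof.
move=> h; apply: val_inj; have [ab|/negPf ab] := boolP (a <= b <= N).
  by rewrite cycE //=; do ?case: ifP; lia.
by rewrite permE /cyc_fun ab.
Qed.

Lemma cycaa a : cyc a a = 1.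
Proof.
apply/permP => x; rewrite perm1; have [aN|aN] := leqP a N; last first.
  by rewrite cyc_out //; have := ltn_ord x; lia.
by apply/val_inj; rewrite cycE ?leqnn //=; do ?case: ifP; lia.
Qed.

Lemma tperm_valE x y z : val (tperm x y z) =
  if z == x :> nat then val y else if z == y :> nat then val x else val z.
Proof.
rewrite !val_eqE; case: tpermP => [->|->|/eqP/negPf-> /eqP/negPf->//].
  by rewrite eqxx.
by rewrite eqxx; case: eqP => // ->.
Qed.

Lemma cycS a b : a <= b < N -> cyc a b.+1 = tperm (inord b) (inord b.+1) * cyc a b.
Proof.
move=> ab; apply/permP => x; apply/val_inj; rewrite permM /= !cycE ?tperm_valE /= ?inordK; try lia.
by have := ltn_ord x; do ?case: ifP; lia.
Qed.

Lemma abslen_cyc a b : a <= b <= N -> abslen (cyc a b) = b - a.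
Proof.
elim: b => [|b IH] ab; first by rewrite (_ : a = 0) ?cycaa ?abslen1 //; lia.
have [E|ab'] := eqVneq a b.+1; first by rewrite E cycaa abslen1 subnn.
rewrite cycS; last lia.
rewrite abslen_tpermL_out ?IH; try lia.
rewrite porbit_fixed; first by rewrite -val_eqE /= !inordK; lia.
by rewrite cyc_out // inordK; lia.
Qed.

Definition full_cycle : 'S_n := cyc 0 N.
Notation c := full_cycle.

Lemma cE x : val (c x) = x.+1 %% n.
Proof.
rewrite cycE ?leqnn //=; have := ltn_ord x; have [h1 h2|h1 h2] := ltnP x N.
  by rewrite modn_small.
by rewrite (_ : val x = N) ?eqxx ?modnn //=; lia.
Qed.

Lemma cXE k x : val ((c ^+ k) x) = (x + k) %% n.
Proof.
elim: k => [|k IH]; first by rewrite expg0 perm1 addn0 modn_small.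
by rewrite expgSr permM cE IH -addn1 modnDml addn1 addnS.
Qed.

Lemma cX_cX j k x : (c ^+ j) ((c ^+ k) x) = (c ^+ (k + j)) x.
Proof. by rewrite expgD permM. Qed.

Lemma cX_small k x : x + k <= N -> val ((c ^+ k) x) = x + k.
Proof. by move=> h; rewrite cXE modn_small. Qed.

Lemma c_order : c ^+ n = 1.
Proof. by apply/permP => x; apply/val_inj; rewrite cXE perm1 modnDr modn_small. Qed.

Lemma abslen_c : abslen c = N.
Proof. by rewrite abslen_cyc ?subn0 ?leqnn. Qed.

Lemma modn_wrap k m : k < m + m -> k %% m = if k < m then k else k - m.
Proof.
move=> h; case: ltnP => [|mk]; first exact: modn_small.
by rewrite -{1}(subnK mk) modnDr modn_small // ltn_subLR.
Qed.

Lemma cycJ a b k : a <= b -> b + k <= N -> cyc a b ^ (c ^+ k) = cyc (a + k) (b + k).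
Proof.
move=> ab bN; apply/permP => y; rewrite -(permKV (c ^+ k) y); set x := _ y.
have xN := ltn_ord x; rewrite permJ; apply/val_inj.
rewrite cXE [RHS]cycE ?cXE ?cycE /=; try lia.
by rewrite !modn_wrap; do ?case: ifP; lia.
Qed.

(** The divisors of the long cycle in the absolute order, that is, the noncrossing permutations. *)
Definition below p := reduced p (p^-1 * c).

Lemma reduced_below p q : reduced p q -> p * q = c -> below p.
Proof. by move=> pq E; rewrite /below -E mulKg. Qed.

Lemma below_c : below c.
Proof. by rewrite /below mulVg /reduced mulg1 abslen1 addn0. Qed.

Lemma below_prefix p q : reduced p q -> below (p * q) -> below p.
Proof.
rewrite /below => pq /reduced_prefix[]// + _.
by rewrite (_ : q * ((p * q)^-1 * c) = p^-1 * c) // invMg !mulpA mulgV mul1g.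
Qed.

Lemma belowJ p k : below p -> below (p ^ (c ^+ k)).
Proof.
rewrite /below => /(@reducedJ _ _ _ (c ^+ k)); rewrite conjMg -conjVg.
by rewrite (_ : c ^ (c ^+ k) = c) // /conjg commuteX // mulKg.
Qed.

Lemma below_suffix p q : reduced p q -> below (p * q) -> below q.
Proof.
move=> /reduced_swap pq pqc; apply: (below_prefix pq).
by rewrite /conjg !mulpA mulgV mul1g.
Qed.

(* A cycle of p steps forward in the cyclic order, except for the step from its largest to its
   smallest point; here the step from v back to p v must not enclose parts of other cycles. *)
Lemma below_interval p (v : 'I_n) : below p -> p v <= v ->
  stable (fun x : 'I_n => p v <= x <= v) p.
Proof.
move=> pc pv; have [E|pv'] := eqVneq (p v) v.
  move=> x; rewrite E => hx; have -> : x = v by apply/val_inj => /=; plia.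
  by rewrite E leqnn.
set t := tperm v (p v); have vpv : v != p v by rewrite eq_sym.
have ltv : p v < v by rewrite ltn_neqAle pv andbT.
have lp : (abslen (t * p)).+1 = abslen p.
  by rewrite abslen_tpermL // porbit_in.
have lp' : (abslen (p * t)).+1 = abslen p by rewrite -lp abslenC.
pose k := p^-1 * c; have ck : c = p * k by rewrite /k mulKVg.
have lk : abslen c = abslen p + abslen k by rewrite ck pc.
have lct : abslen c = (abslen (t * c)).+1.
  have := abslenM_le (t * p) k; have := abslen_tperm_le (t * c) v (p v).
  by rewrite -/t mulpA tperm2 mul1g -mulpA -ck; plia.
have ptk : p * t * (t * k * t) = c * t.
  by rewrite mul_tpermK ck.
have lktt : abslen (t * k * t) = abslen k by rewrite abslen_tpermJ.
have red : reduced (p * t) (t * k * t) by rewrite /reduced ptk abslenC lktt; plia.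
(* Composing with [t] closes the points from [p v] to [v - 1] into a cycle of [c * t]; this set is
   then stable under the prefix [p * t] as well. *)
have st : stable (fun x : 'I_n => p v <= x < v) (p * t * (t * k * t)).
  rewrite ptk => x hx.
  have vN := ltn_ord v; have cx : c x = x.+1 :> nat by rewrite [LHS]cE modn_small; plia.
  by rewrite permM tperm_valE /= cx; do ?case: ifP; plia.
have [st' _] := stable_reduced red st.
move=> x hx; have [->|xv] := eqVneq x v; first by rewrite leqnn.
have /st' : p v <= x < v by move: xv hx; rewrite -val_eqE /=; plia.
by rewrite permM tperm_valE /=; do ?case: ifP; plia.
Qed.

End IntervalCycles.

(** * Minimal factorizations of cycles *)

Section Factorizations.
Variables (T : finType) (r : nat).
Implicit Types (s : {ffun 'I_r -> {perm T}}) (p a b : {perm T}) (P : pred T).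

Definition minfact p := [set s : {ffun 'I_r -> {perm T}} |
  (\prod_j s j == p) && ((\sum_j abslen (s j))%N == abslen p)].

(** Interpolates between all factorizations, for [k = 0], and none, for [k = r] when [p] moves [v];
    the recursion on [k] locates the first factor that moves [v]. *)
Definition minfact_fixing k p v := [set s in minfact p | [forall j : 'I_r, (j < k) ==> (s j v == v)]].

Lemma in_minfact s p : (s \in minfact p) = (\prod_j s j == p) && ((\sum_j abslen (s j))%N <= abslen p).
Proof.
rewrite inE; case: eqP => //= <-; apply/eqP/idP => [->//|H].
by apply/eqP; rewrite eqn_leq H abslen_prod_le.
Qed.

Lemma minfactP s p : reflect (\prod_j s j = p /\ ((\sum_j abslen (s j))%N = abslen p)) (s \in minfact p).
Proof. by rewrite inE; apply: (iffP andP) => -[/eqP ? /eqP ?]. Qed.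

Lemma minfact_fixingP k p v s : reflect
  (s \in minfact p /\ (forall j : 'I_r, j < k -> s j v = v)) (s \in minfact_fixing k p v).
Proof.
rewrite [s \in minfact_fixing _ _ _]in_set; apply: (iffP andP) => -[sp H]; split=> //.
  by move=> j jk; apply/eqP; move/forallP/(_ j)/implyP: H; exact.
by apply/forallP => j; apply/implyP => jk; apply/eqP/H.
Qed.

Lemma minfact_fixing0 p v : minfact_fixing 0 p v = minfact p.
Proof. by apply/setP => s; apply/minfact_fixingP/idP => [[]|]. Qed.

Lemma prod_perm_cons (I : Type) (x : I) l (F : I -> {perm T}) :
  \prod_(i <- x :: l) F i = F x * \prod_(i <- l) F i.
Proof. exact: big_cons. Qed.

Lemma stable_prod (I : eqType) (l : seq I) (F : I -> {perm T}) P :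
  (\sum_(i <- l) abslen (F i))%N = abslen (\prod_(i <- l) F i) ->
  stable P (\prod_(i <- l) F i) -> {in l, forall i, stable P (F i)}.
Proof.
elim: l => [|x l IH]; first by [].
rewrite prod_perm_cons big_cons => H; have H1 := abslen_prod_le l F.
have H2 := abslenM_le (F x) (\prod_(i <- l) F i).
have E : (\sum_(i <- l) abslen (F i))%N = abslen (\prod_(i <- l) F i) by plia.
have red : reduced (F x) (\prod_(i <- l) F i) by rewrite /reduced -H E.
move=> /(stable_reduced red)[Px Pl] i; rewrite inE => /predU1P[->//|].
exact: IH.
Qed.

Lemma minfact_stable s p P : s \in minfact p -> stable P p -> forall j, stable P (s j).
Proof.
by move=> /minfactP[E1 E2] Pp j; apply: (@stable_prod _ (index_enum _) s); rewrite ?E1 // mem_index_enum.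
Qed.

Lemma minfact_fix s p x : s \in minfact p -> p x = x -> forall j, s j x = x.
Proof.
move=> sp px j; have st : stable (pred1 x) p by move=> y /eqP ->; rewrite /= px.
by apply/eqP/(minfact_stable sp st); rewrite /= eqxx.
Qed.

(* A transposition t split off from the k-th factor moves to the front of the product,
   conjugating the factors it passes. *)
Section Hurwitz.
Variables (t : {perm T}) (k : nat).

Definition hurwitz (m : nat) (g : 'I_m -> {perm T}) (j : 'I_m) :=
  if j < k then g j ^ t else if j == k :> nat then t * g j else g j.

Hypothesis tt : t * t = 1.

Let tV : t^-1 = t. Proof. by apply/eqP; rewrite eq_invg_mul tt. Qed.

Lemma hurwitzK m (g : 'I_m -> {perm T}) : hurwitz (hurwitz g) =1 g.
Proof.
move=> j; rewrite /hurwitz; case: ltngtP => _ //; last by rewrite mulgA tt mul1g.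
by rewrite -conjgM tt conjg1.
Qed.

Lemma prod_hurwitz_lt m (g : 'I_m -> {perm T}) : m <= k ->
  \prod_j hurwitz g j = (\prod_j g j) ^ t.
Proof.
elim: m g => [|m IH] g mk; first by rewrite !big_ord0 conj1g.
rewrite !big_ord_recr /= conjMg -IH ?(ltnW mk) // /hurwitz /= mk.
by congr (_ * _).
Qed.

Lemma prod_hurwitz m (g : 'I_m -> {perm T}) : k < m ->
  \prod_j hurwitz g j = t * \prod_j g j.
Proof.
elim: m g => [//|m IH] g; rewrite ltnS leq_eqVlt => /predU1P[E|km].
  rewrite !big_ord_recr /= (_ : hurwitz g ord_max = t * g ord_max).
    rewrite (@prod_hurwitz_lt m (fun i => g (widen_ord (leqnSn m) i))) ?E //.
    by rewrite /conjg tV -!mulgA (mulgA t t) tt mul1g.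
  by rewrite /hurwitz /= E ltnn eqxx.
rewrite !big_ord_recr /= mulgA -IH // (_ : hurwitz g ord_max = g ord_max) //.
by rewrite /hurwitz /= ltnNge (ltnW km) /= eq_sym (ltn_eqF km).
Qed.

End Hurwitz.

Definition hurwitz_move x y k s := [ffun j => hurwitz (tperm x y) k s j].

Lemma hurwitz_moveK x y k : involutive (hurwitz_move x y k).
Proof.
move=> s; apply/ffunP => j; rewrite ffunE -[RHS](@hurwitzK _ k (tperm2 x y) _ s).
by rewrite {1}/hurwitz !ffunE.
Qed.

Lemma prod_hurwitz_move x y k s : k < r ->
  \prod_j hurwitz_move x y k s j = tperm x y * \prod_j s j.
Proof.
move=> kr; rewrite -(@prod_hurwitz _ k (tperm2 x y)) //.
by apply: eq_bigr => j _; rewrite ffunE.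
Qed.

Lemma abslen_hurwitz_move x y k s (kr : k < r) :
  (\sum_j abslen (hurwitz_move x y k s j) + abslen (s (Ordinal kr)) =
  \sum_j abslen (s j) + abslen (tperm x y * s (Ordinal kr)))%N.
Proof.
rewrite (bigD1 (Ordinal kr)) // [in RHS](bigD1 (Ordinal kr)) //=.
rewrite ffunE {1}/hurwitz /= ltnn eqxx.
rewrite (eq_bigr (fun j => abslen (s j))).
  by rewrite addnAC [RHS]addnAC; congr (_ + _)%N; rewrite addnC.
move=> j; rewrite -val_eqE /= ffunE /hurwitz => /negPf ->.
by case: ifP; rewrite ?abslenJ.
Qed.

(** Splitting [tperm v q] off the factor of index [k] and moving it to the front is a bijection. The
    earlier factors are conjugated and fix [q] instead of [v]; the factor of index [k], which sent
    [v] to [q], now fixes [q]. *)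
Lemma card_minfact_moving k p v q (kr : k < r) : q != v -> q \in porbit p v ->
  #|[set s in minfact_fixing k p v | s (Ordinal kr) v == q]| =
  #|minfact_fixing k.+1 (tperm v q * p) q|.
Proof.
move=> qv qp; set t := tperm v q; set k' := Ordinal kr.
have ltp : (abslen (t * p)).+1 = abslen p by apply: abslen_tpermL; rewrite 1?eq_sym.
rewrite -(card_imset _ (inv_inj (hurwitz_moveK v q k))); apply: eq_card => s'.
apply/imsetP/minfact_fixingP => [[s]|[/minfactP[E1 E2] H]].
  rewrite [s \in _]in_set => /andP[/minfact_fixingP[/minfactP[E1 E2] H] /eqP sk ->].
  split=> [|j jk].
    rewrite in_minfact prod_hurwitz_move // E1 eqxx /=.
    have H1 := @abslen_hurwitz_move v q k s kr.
    have H2 : (abslen (t * s k')).+1 = abslen (s k').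
      by apply: abslen_tpermL; [rewrite eq_sym | rewrite -sk porbit_in].
    have arith (l1 l2 l3 l4 m m' : nat) : l1 + l2 = m + l4 -> l4.+1 = l2 -> m = l3 ->
      m'.+1 = l3 -> l1 <= m' by lia.
    exact: arith H1 H2 E2 ltp.
  rewrite ffunE /hurwitz; case: (ltngtP j k) => jk'; last 1 first.
  - by rewrite permM tpermR (_ : j = k') //; apply: val_inj.
  - by rewrite -{2}(tpermL v q) permJ H // tpermL.
  - by move: jk; rewrite ltnS leqNgt jk'.
exists (hurwitz_move v q k s'); last by rewrite hurwitz_moveK.
rewrite in_set; apply/andP; split; last first.
  by rewrite ffunE /hurwitz /= ltnn eqxx permM tpermL H.
apply/minfact_fixingP; split=> [|j jk].
  rewrite in_minfact prod_hurwitz_move // E1 /t mulgA tperm2 mul1g eqxx /=.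
  have arith (l1 l2 l3 l4 m m' : nat) : l1 + l2 = m + l4 -> l4 <= l2.+1 -> m = m' ->
    m'.+1 = l3 -> l1 <= l3 by lia.
  exact: arith (@abslen_hurwitz_move v q k s' kr) (abslen_tperm_le _ _ _) E2 ltp.
by rewrite ffunE /hurwitz jk -{2}(tpermR v q) permJ H ?tpermR // ltnW.
Qed.

(** Sort by the image of [v] under the factor of index [k]. The image stays in the cycle of [v]
    under [p], because the factors of a reduced factorization preserve the cycles of the product. *)
Lemma card_minfact_fixingS k p v : k < r -> #|minfact_fixing k p v| =
  (#|minfact_fixing k.+1 p v| + \sum_(q | (q != v) && (q \in porbit p v))
     #|minfact_fixing k.+1 (tperm v q * p) q|)%N.
Proof.
move=> kr; rewrite -sum1_card (partition_big (fun s => s (Ordinal kr) v) xpredT) //=.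
rewrite (bigD1 v) //=; congr (_ + _)%N.
  rewrite sum1_card; apply: eq_card => s; rewrite unfold_in.
  apply/andP/minfact_fixingP => [[/minfact_fixingP[sp H] /eqP sk]|[sp H]].
    split=> // j; rewrite ltnS leq_eqVlt => /predU1P[jk|/H //].
    by rewrite (_ : j = Ordinal kr) //; apply: val_inj.
  by split; [apply/minfact_fixingP; split=> // j jk; apply: H; exact: ltnW | rewrite H].
rewrite (bigID (mem (porbit p v))) /= [X in (_ + X)%N]big1 ?addn0 => [|q /andP[qv qp]].
  apply: eq_bigr => q /andP[qv qp]; rewrite -(card_minfact_moving kr qv qp) sum1_card.
  by apply: eq_card => s; rewrite in_set.
rewrite big1 // => s /andP[/minfact_fixingP[sp _] /eqP sq]; case/negP: qp; rewrite -sq.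
have st : stable (mem (porbit p v)) p.
  by move=> _ /porbitP[i ->]; rewrite -permM -expgSr; exact: mem_porbit.
by apply: (minfact_stable sp st); exact: porbit_id.
Qed.


(** * Factorizations of a product of permutations with disjoint supports *)

Definition restr P p := restr_perm [set x | P x] p.

Lemma restrE P p x : stable P p -> P x -> restr P p x = p x.
Proof.
move=> Pp Px; apply: restr_permE; last by rewrite inE.
by rewrite !inE; apply/subsetP => y; rewrite !inE; exact: Pp.
Qed.

Lemma restr_out P p x : ~~ P x -> restr P p x = x.
Proof. by move=> Px; apply: (out_perm (restr_perm_on _ _)); rewrite inE. Qed.

Lemma restr_supp P p x : restr P p x != x -> P x.
Proof. by apply: contraNT => /restr_out ->. Qed.

Lemma restr_mulC P p : stable P p -> restr P p * restr (predC P) p = p.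
Proof.
move=> Pp; apply/permP => x; rewrite permM; have [Px|Px] := boolP (P x).
  by rewrite (restrE Pp) // restr_out //= negbK; exact: Pp.
by rewrite (restr_out p Px) (restrE (stableC Pp)).
Qed.

Lemma disjoint_commute P a b : (forall x, a x != x -> P x) ->
  (forall x, b x != x -> ~~ P x) -> commute a b.
Proof.
move=> aP bP; apply/permP => x; rewrite !permM.
have fa y : ~~ P y -> a y = y by move=> Py; apply/eqP; apply: contraNT Py => /aP.
have fb y : P y -> b y = y by move=> Py; apply/eqP; apply: contraTT Py => /bP.
have [ax|ax] := eqVneq (a x) x.
  rewrite ax; have [->|bx] := eqVneq (b x) x; first by rewrite ax.
  by rewrite fa // bP // (inj_eq perm_inj).
by rewrite (fb x) ?aP // fb // aP // (inj_eq perm_inj).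
Qed.

Lemma supp_stable P a : (forall x, a x != x -> P x) -> stable P a.
Proof.
move=> aP x Px; have [->//|ax] := eqVneq (a x) x.
by apply: aP; rewrite (inj_eq perm_inj).
Qed.

Lemma suppC_stable P a : (forall x, a x != x -> ~~ P x) -> stable P a.
Proof. by move=> aP x Px; have [->//|/aP] := eqVneq (a x) x; rewrite Px. Qed.

Lemma restr_mul P a b : (forall x, a x != x -> P x) ->
  (forall x, b x != x -> ~~ P x) -> restr P (a * b) = a.
Proof.
move=> aP bP; have Pa := supp_stable aP; have Pb := suppC_stable bP.
apply/permP => x; have [Px|Px] := boolP (P x).
  rewrite restrE ?permM; [|exact: stableM|by []].
  by apply/eqP; apply: contraTT (Pa x Px) => /bP.
by rewrite restr_out //; apply/esym/eqP; apply: contraNT Px => /aP.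
Qed.

Lemma supp_prod (I : Type) (l : seq I) (F : I -> {perm T}) P :
  (forall i x, F i x != x -> P x) -> forall x, (\prod_(i <- l) F i) x != x -> P x.
Proof.
move=> FP x; apply: contraNT => Px; elim: l => [|i l IH]; first by rewrite big_nil perm1.
rewrite big_cons permM; have /eqP -> // : F i x == x.
by apply: contraNT Px => /FP.
Qed.

Lemma minfact_supp s p P : s \in minfact p -> (forall x, p x != x -> P x) ->
  forall j x, s j x != x -> P x.
Proof.
move=> sp pP j x; apply: contraNT => Px; apply/eqP/(minfact_fix sp)/eqP.
by apply: contraNT Px => /pP.
Qed.

(** Each factor preserves [P], so it splits into its restrictions to [P] and to the complement,
    which yield a factorization of [a] and one of [b]. Since [v] is in [P], only the first can move
    it. *)
Lemma card_minfact_mul k P a b v : (forall x, a x != x -> P x) ->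
  (forall x, b x != x -> ~~ P x) -> P v ->
  #|minfact_fixing k (a * b) v| = (#|minfact_fixing k a v| * #|minfact b|)%N.
Proof.
move=> aP bP Pv; rewrite -cardsX.
pose f (u : {ffun 'I_r -> {perm T}} * {ffun 'I_r -> {perm T}}) := [ffun j => u.1 j * u.2 j].
pose g s := ([ffun j => restr P (s j)], [ffun j => restr (predC P) (s j)]).
have bP' x : b x != x -> predC P x by move/bP.
have aP' x : a x != x -> ~~ predC P x by rewrite negbK; exact: aP.
rewrite -(@card_in_imset _ _ f); last first.
  apply: (@can_in_inj _ _ _ _ g) => -[s1 s2] /setXP[/minfact_fixingP[s1a _] s2b].
  have H1 := minfact_supp s1a aP; have H2 := minfact_supp s2b bP'.
  have H1' j x : s1 j x != x -> ~~ predC P x by rewrite negbK; exact: H1.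
  congr (_, _); apply/ffunP => j; rewrite !ffunE /=.
    by rewrite restr_mul //; [exact: H1|exact: H2].
  by rewrite (disjoint_commute (H1 j) (H2 j)) restr_mul //; [exact: H2|exact: H1'].
apply: eq_card => s; apply/minfact_fixingP/imsetP => [[sab H]|[[s1 s2]]].
  have Pab : stable P (a * b) by apply: stableM; [exact: supp_stable|exact: suppC_stable].
  have Ps := minfact_stable sab Pab.
  have E j : restr P (s j) * restr (predC P) (s j) = s j by apply: restr_mulC.
  pose F j := restr P (s j); pose G j := restr (predC P) (s j).
  have FP j x : F j x != x -> P x by exact: restr_supp.
  have GP j x : G j x != x -> predC P x by exact: restr_supp.
  have sE : \prod_j s j = \prod_j F j * \prod_j G j.
    rewrite -prodgM_commute; first by apply: eq_bigr => j _; rewrite E.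
    by move=> i j _ _; exact: disjoint_commute (FP i) (GP j).
  have [sp sl] := minfactP _ _ sab; rewrite sE in sp.
  have PF := supp_prod (l := index_enum _) FP; have PG := supp_prod (l := index_enum _) GP.
  have Fa : \prod_j F j = a by rewrite -(restr_mul PF PG) sp restr_mul.
  have Gb : \prod_j G j = b by apply: (mulgI a); rewrite -{1}Fa.
  have lE : (\sum_j abslen (s j) = \sum_j abslen (F j) + \sum_j abslen (G j))%N.
    by rewrite -big_split; apply: eq_bigr => j _; rewrite -{1}E; apply: (reduced_disjoint (FP j) (GP j)).
  have lF := abslen_prod_le (index_enum _) F; have lG := abslen_prod_le (index_enum _) G.
  rewrite Fa in lF; rewrite Gb in lG.
  (* The two parts have total length [abslen a + abslen b], and neither is shorter than its product,
     so both bounds are tight. *)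
  have [lF' lG'] : (\sum_j abslen (F j) <= abslen a)%N /\ (\sum_j abslen (G j) <= abslen b)%N.
    have arith (x f0 g0 l la lb : nat) : x = f0 + g0 -> x = l -> l = la + lb -> la <= f0 ->
      lb <= g0 -> f0 <= la /\ g0 <= lb by lia.
    exact: arith lE sl (reduced_disjoint aP bP) lF lG.
  exists (g s); last by apply/ffunP => j; rewrite !ffunE E.
  rewrite in_setX in_minfact; apply/andP; split; last first.
    rewrite (eq_bigr G) ?Gb ?eqxx /=; last by move=> j _; rewrite ffunE.
    by rewrite (eq_bigr (fun j => abslen (G j))) ?lG' // => j _; rewrite ffunE.
  apply/minfact_fixingP; split=> [|j jk]; last first.
    by rewrite ffunE restrE // H.
  rewrite in_minfact (eq_bigr F) ?Fa ?eqxx /=; last by move=> j _; rewrite ffunE.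
  by rewrite (eq_bigr (fun j => abslen (F j))) ?lF' // => j _; rewrite ffunE.
move=> /setXP[/minfact_fixingP[s1a H] s2b] ->.
have H1 := minfact_supp s1a aP; have H2 := minfact_supp s2b bP'.
have [E1 l1] := minfactP _ _ s1a; have [E2 l2] := minfactP _ _ s2b.
split=> [|j jk].
  rewrite in_minfact; apply/andP; split.
    rewrite (eq_bigr (fun j => s1 j * s2 j)); last by move=> j _; rewrite ffunE.
    rewrite prodgM_commute ?E1 ?E2 // => i j _ _.
    exact: disjoint_commute (H1 i) (H2 j).
  rewrite (reduced_disjoint aP bP) -l1 -l2 -big_split; apply: leq_sum => j _.
  by rewrite ffunE abslenM_le.
rewrite ffunE permM H //; apply/eqP; apply: contraTT Pv => /H2; exact.
Qed.

Lemma card_minfactJ p g : #|minfact (p ^ g)| = #|minfact p|.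
Proof.
suff le q h : #|minfact q| <= #|minfact (q ^ h)|.
  by apply/eqP; rewrite eqn_leq le andbT -{2}(conjgK g p) le.
pose f s : {ffun 'I_r -> {perm T}} := [ffun j => s j ^ h].
have f_inj : injective f.
  by move=> s s' /ffunP E; apply/ffunP => j; have := E j; rewrite !ffunE; exact: conjg_inj.
rewrite -(card_imset _ f_inj); apply/subset_leq_card/subsetP => _ /imsetP[s /minfactP[<- l] ->].
rewrite in_minfact (eq_bigr (fun j => s j ^ h)); last by move=> j _; rewrite ffunE.
rewrite -conjg_prod eqxx /= abslenJ -l; apply: leq_sum => j _.
by rewrite ffunE abslenJ.
Qed.

Lemma minfact_fixing_all p v : p v != v -> minfact_fixing r p v = set0.
Proof.
move=> pv; apply/setP => s; rewrite [RHS]in_set0; apply/negP => /minfact_fixingP[/minfactP[E _] H].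
case/eqP: pv; rewrite -E; apply: (big_ind (fun q : {perm T} => q v = v)) => //.
- by rewrite perm1.
- by move=> q1 q2 E1 E2; rewrite permM E1.
- by move=> j _; exact: H.
Qed.

Lemma card_minfact1 : #|minfact 1| = 1%N.
Proof.
rewrite -(cards1 ([ffun => 1] : {ffun 'I_r -> {perm T}})); apply: eq_card => s.
rewrite in_set1; apply/idP/eqP => [s1|->].
  apply/ffunP => j; rewrite ffunE; apply/permP => x.
  by rewrite (minfact_fix s1) ?perm1.
rewrite in_minfact big1 ?eqxx /= => [|j _]; last by rewrite ffunE.
by rewrite abslen1 leqn0 big1 // => j _; rewrite ffunE abslen1.
Qed.

End Factorizations.

(** * Counting the factorizations of a cycle *)

Section CycleFactorizations.
Variables (N r : nat).
Notation n := N.+1.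

Lemma ord_inord m : m <= N -> @inord N m = m :> nat.
Proof. exact: inordK. Qed.

Lemma cyc_expr0 m i : i <= m <= N -> ((cyc N 0 m) ^+ i) (inord 0) = inord i.
Proof.
elim: i => [|i IH] im; first by rewrite expg0 perm1.
rewrite expgSr permM IH; last lia.
by apply: val_inj; rewrite cycE /= ?ord_inord; [case: ifP; lia|lia|lia|lia].
Qed.

Lemma porbit_cyc m (q : 'I_n) : m <= N -> (q \in porbit (cyc N 0 m) (inord m)) = (q <= m).
Proof.
move=> mN; apply/idP/idP => [qm|qm].
  apply: (stable_porbit (P := fun x : 'I_n => x <= m) _ qm); last by rewrite ord_inord.
  by move=> x xm; rewrite cycE /=; do ?case: ifP; lia.
rewrite -eq_porbit_mem; apply/eqP.
have H i : i <= m -> porbit (cyc N 0 m) (inord i) = porbit (cyc N 0 m) (inord 0).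
  by move=> im; rewrite -(@cyc_expr0 m i) ?porbit_perm //; lia.
by rewrite H // -(inord_val q) H.
Qed.

Lemma tperm_cyc m (q : 'I_n) : q < m <= N ->
  tperm (inord m) q * cyc N 0 m = cyc N 0 q * cyc N q.+1 m.
Proof.
move=> qm; apply/permP => x; apply: val_inj; have xN := ltn_ord x.
rewrite !permM !cycE ?tperm_valE /= ?ord_inord; try lia.
by do ?case: ifP; lia.
Qed.

(** Here [e] is the number of points of the cycle. The value 1 at 0 is the empty tree; it accounts
    for the case in which the next factor fixes the top point. *)
Definition num_minfact e := if e is e'.+1 then #|minfact r (cyc N 0 e')| else 1%N.

Lemma card_minfact_cyc a b : a <= b <= N -> #|minfact r (cyc N a b)| = num_minfact (b - a).+1.
Proof.
move=> ab; rewrite /num_minfact -(@card_minfactJ _ _ (cyc N 0 _) ((full_cycle N) ^+ a)) cycJ ?subnK //; lia.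
Qed.

(** A factor that sends the top point [m] to [q] cuts the cycle into one on [0], ..., [q] and one on
    [q + 1], ..., [m]; the fixing condition passes to the top point of the first. *)
Lemma card_minfact_fixing_cyc k m : k < r -> m <= N ->
  #|minfact_fixing r k (cyc N 0 m) (inord m)| =
  (\sum_(q < m.+1) #|minfact_fixing r k.+1 (cyc N 0 q) (inord q)| * num_minfact (m - q))%N.
Proof.
move=> kr mN; rewrite card_minfact_fixingS // big_ord_recr /= subnn muln1 addnC.
congr (_ + _)%N; rewrite (big_ord_widen n (fun q => #|minfact_fixing r k.+1 (cyc N 0 q) (inord q)| *
  num_minfact (m - q))%N); last lia.
apply: eq_big => [q|q]; rewrite porbit_cyc // -val_eqE /= ord_inord //; first lia.
move=> qm; have {}qm : q < m by lia.
rewrite tperm_cyc ?qm // (@card_minfact_mul _ _ _ (fun x : 'I_n => x <= q)) //.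
- by rewrite card_minfact_cyc ?inord_val; [congr (_ * num_minfact _)%N; lia|lia].
- by move=> x; apply: contraNT => xq; rewrite cyc_out //; lia.
- by move=> x; apply: contraNN => xq; rewrite cyc_out //; lia.
Qed.

Theorem card_minfact_cycle M : 0 < r -> 0 < M <= N -> (M * num_minfact M = 'C(r * M, M.-1))%N.
Proof.
move=> r_gt0 /andP[M_gt0 MN].
(* In [A k] there are [k] factors free to move the top point, so its index runs against that of
   [minfact_fixing]; [A r] counts all factorizations of a cycle on [m + 1] points. *)
pose A k m := #|minfact_fixing r (r - k) (cyc N 0 m) (inord m)|.
apply: (@fuss_catalan r M num_minfact A) => //.
- move=> m mM; rewrite /A subn0; case: m mM => [|m] mM.
    rewrite cycaa; transitivity #|minfact r (1 : 'S_n)|; last exact: card_minfact1.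
    apply: eq_card => s; apply/minfact_fixingP/idP => [[]//|s1]; split=> // j _.
    by rewrite (minfact_fix s1) ?perm1.
  rewrite minfact_fixing_all ?cards0 // -val_eqE /= cycE ?ord_inord; try lia.
  by do ?case: ifP; lia.
- move=> k m kr mM; rewrite /A card_minfact_fixing_cyc; try lia.
  by apply: eq_bigr => q _; rewrite subnSK.
- by move=> m mM; rewrite /A subnn minfact_fixing0.
Qed.

End CycleFactorizations.

(** * Permutations with (c^d w)^r = 1 *)

Section PeriodicPermutations.
Variables (r d : nat).
Hypotheses (r_ge2 : 1 < r) (d_gt0 : 0 < d).
Notation N := (r * d)%N.
Notation n := N.+1.
Notation c := (full_cycle N).
Implicit Types (w a b : 'S_n) (x y i : 'I_n).

(** These turn out to be the images of the simple elements [s] for which [delta ^ d * s] lies in the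
    super summit set. *)
Definition periodic : {set 'S_n} := [set w | (abslen w == d) && ((c ^+ d * w) ^+ r == 1)].

Lemma periodicP w : reflect (abslen w = d /\ (c ^+ d * w) ^+ r = 1) (w \in periodic).
Proof. by rewrite inE; apply: (iffP andP) => -[/eqP ? /eqP ?]. Qed.

(* The product of the translates of w by (k-1)d, ..., d, 0. *)
Definition twisted_power w k : 'S_n := (c ^+ (d * k))^-1 * (c ^+ d * w) ^+ k.

Lemma twisted_powerD w j k :
  twisted_power w (j + k) = twisted_power w j ^ (c ^+ (d * k)) * twisted_power w k.
Proof. by rewrite /twisted_power /conjg mulnDr !expgD invMg !mulgA mulgK. Qed.

Lemma twisted_power1 w : twisted_power w 1 = w.
Proof. by rewrite /twisted_power muln1 expg1 mulKg. Qed.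

(** As [r * d + 1 = n], the inverse of [c ^+ (d * r)] is [c] itself. *)
Lemma twisted_power_r w : (c ^+ d * w) ^+ r = 1 -> twisted_power w r = c.
Proof.
move=> wr; rewrite /twisted_power wr mulg1; apply: (mulgI (c ^+ (d * r))).
by rewrite mulgV -expgSr mulnC c_order.
Qed.

Lemma abslen_twisted_power_le w k : abslen (twisted_power w k) <= k * abslen w.
Proof.
elim: k => [|k IH]; first by rewrite /twisted_power muln0 invg1 mul1g expg0 abslen1.
rewrite -(add1n k) twisted_powerD twisted_power1 mulnDl mul1n.
by rewrite (leq_trans (abslenM_le _ _)) // abslenJ leq_add2l.
Qed.

Lemma periodic_abslen_ge w : (c ^+ d * w) ^+ r = 1 -> d <= abslen w.
Proof.
move=> wr; have := abslen_twisted_power_le w r; rewrite twisted_power_r // abslen_c.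
by rewrite leq_pmul2l //; lia.
Qed.

(** All [r] translates, of length [d] each, multiply to [c], of length [r * d]; no partial product
    can lose length. *)
Lemma abslen_twisted_power w k : w \in periodic -> k <= r ->
  abslen (twisted_power w k) = (k * d)%N.
Proof.
move=> /periodicP[wd wr] kr; have := abslen_twisted_power_le w k.
have := abslen_twisted_power_le w (r - k).
have := abslenM_le (twisted_power w (r - k) ^ (c ^+ (d * k))) (twisted_power w k).
rewrite -twisted_powerD subnK // twisted_power_r // abslen_c abslenJ wd mulnBl.
have : (k * d <= r * d)%N by rewrite leq_pmul2r.
have arith (x1 x2 y1 y2 : nat) : x1 <= x2 -> x2 <= y1 + y2 -> y1 <= x2 - x1 -> y2 <= x1 -> y2 = x1.
  by lia.
exact: arith.
Qed.

Lemma reduced_twisted_power w j k : w \in periodic -> j + k <= r ->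
  reduced (twisted_power w j ^ (c ^+ (d * k))) (twisted_power w k).
Proof.
by move=> wX jk; rewrite /reduced -twisted_powerD abslenJ !abslen_twisted_power //; lia.
Qed.

Lemma below_twisted_power w k : w \in periodic -> k <= r -> below (twisted_power w k).
Proof.
move=> wX kr; have := @reduced_twisted_power w (r - k) k wX; rewrite subnK // => /(_ (leqnn _)) H.
apply: (below_suffix H); rewrite -twisted_powerD subnK // twisted_power_r; first exact: below_c.
by case/periodicP: wX.
Qed.

Lemma periodicJ w j : w \in periodic -> w ^ (c ^+ j) \in periodic.
Proof.
move=> /periodicP[wd wr]; apply/periodicP; split; first by rewrite abslenJ.
have -> : c ^+ d * w ^ (c ^+ j) = (c ^+ d * w) ^ (c ^+ j).
  by rewrite conjMg (_ : (c ^+ d) ^ _ = c ^+ d) // /conjg -expgD addnC expgD mulKg.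
by rewrite -conjXg wr conj1g.
Qed.

Lemma turnJ w j x : (c ^+ d * w ^ (c ^+ j)) ((c ^+ j) x) = (c ^+ j) ((c ^+ d * w) x).
Proof.
have E : (c ^+ d) ((c ^+ j) x) = (c ^+ j) ((c ^+ d) x) by rewrite !cX_cX addnC.
by rewrite [LHS]permM E permJ [in RHS]permM.
Qed.

(** Write [c] as the reduced product [a * w * e] with [a] a translate of [w]. Were the image [z]
    smaller, [a] would send [N] to [z + d], hence [w * e] would send [z + d] to 0. The interval from
    0 to [z + d] would then be stable under [w], which however maps [N - d] from outside it to [z]
    inside. *)
Lemma periodic_lower_bound w : w \in periodic -> N - (d + d) <= w (inord (N - d)).
Proof.
move=> wX; rewrite leqNgt; apply/negP; set y := inord _; set z := w y => zN.
have dN : d <= N by nia.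
have yE : y = N - d :> nat by rewrite inordK // ltnS leq_subr.
pose a := w ^ (c ^+ d); pose e := (a * w)^-1 * c.
have aw : twisted_power w 2 = a * w.
  by rewrite (twisted_powerD w 1 1) !twisted_power1 muln1.
have red_aw : reduced a w.
  by have := @reduced_twisted_power w 1 1 wX; rewrite !twisted_power1 muln1; apply.
have := @below_twisted_power w 2 wX r_ge2; rewrite /below aw -/e => red_awe.
have [red1 red2] := reduced_prefix red_awe red_aw.
have awe : a * (w * e) = c by rewrite /e mulgA mulKVg.
have bwe : below (w * e) by apply: (below_suffix red1); rewrite awe; exact: below_c.
pose v : 'I_n := inord (z + d).
have vE : v = z + d :> nat by rewrite inordK // ltnS; lia.
have av : a (inord N) = v.
  have -> : inord N = (c ^+ d) y by apply: val_inj; rewrite /= inordK // cX_small yE; lia.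
  by rewrite permJ; apply: val_inj; rewrite cX_small -/z ?vE //; lia.
have wev : (w * e) v = ord0.
  rewrite -av -permM awe; apply: val_inj; rewrite cE inordK // modnn //.
have := @below_interval _ _ v bwe; rewrite wev /= => /(_ isT) st.
have [/stableC st' _] := stable_reduced red2 st.
by have := st' y; rewrite /= vE yE -/z; lia.
Qed.

(** Rotate [i] to [N - 2d]: by the lower bound its image lies between that point and [N]. *)
Lemma periodic_turn w i : w \in periodic ->
  exists2 D, D <= d + d & (c ^+ d * w) i = (c ^+ D) i.
Proof.
move=> wX; pose p : 'I_n := inord (N - (d + d)).
have dN : d + d <= N by nia.
have pE : p = N - (d + d) :> nat by rewrite inordK // ltnS leq_subr.
pose j := (p + (n - i))%N; have ji : (c ^+ j) i = p.
  apply: val_inj; rewrite cXE /j.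
  by rewrite addnCA subnKC ?modnDr ?modn_small // ltnW.
pose q := (c ^+ j) ((c ^+ d * w) i); have pq : p <= q.
  rewrite /q -turnJ ji permM (_ : (c ^+ d) p = inord (N - d)).
    by rewrite pE; exact: periodic_lower_bound (periodicJ j wX).
  by apply: val_inj; rewrite cX_small pE /= ?inordK; lia.
have qN := ltn_ord q; exists (q - p); first by rewrite pE; lia.
apply: (@perm_inj _ (c ^+ j)); rewrite cX_cX addnC -cX_cX ji -/q.
by apply: val_inj; rewrite cX_small subnKC.
Qed.


Lemma periodic_fixed w : w \in periodic -> exists i, (c ^+ d * w) i = i.
Proof.
move=> wX; set u := c ^+ d * w.
have [/existsP[i /eqP ui]|/existsPn nofix] := boolP [exists i, u i == i]; first by exists i.
exfalso.
have ur : u ^+ r = 1 by case/periodicP: wX.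
pose D i := (u i + (n - i)) %% n.
have dN : d + d <= N by nia.
have DE i : u i = (c ^+ D i) i /\ D i <= d + d.
  have [k kd E] := periodic_turn i wX; suff -> : D i = k by [].
  have iN := ltn_ord i; rewrite /D -/u in E *; rewrite E cXE modnDml addnAC subnKC; last exact: ltnW.
  by rewrite modnDl modn_small //; lia.
have D_gt0 i : 0 < D i.
  rewrite lt0n; apply: contraNneq (nofix i) => D0.
  by have [-> _] := DE i; rewrite D0 expg0 perm1.
pose S k i := (\sum_(j < k) D ((u ^+ j) i))%N.
have SE k i : (u ^+ k) i = (c ^+ S k i) i.
  elim: k => [|k IH]; first by rewrite /S big_ord0 !expg0.
  by rewrite expgSr permM (DE _).1 {2}IH cX_cX /S big_ord_recr.
(* The total turn over [r] steps is a multiple of [n] because [u ^+ r = 1]. It is positive and at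
   most [2 * N], so it equals [n]. *)
have Sn i : S r i = n.
  have : n %| S r i.
    have /(congr1 val) := SE r i; rewrite ur perm1 cXE => E.
    by rewrite /dvdn -[0](mod0n n) -(eqn_modDl i) addn0 -E modn_small.
  have S_gt0 : 0 < S r i by rewrite /S (bigD1 (Ordinal (ltnW r_ge2))) //= ltn_addr.
  have S_le : S r i <= N + N.
    apply: (@leq_trans (\sum_(j < r) (d + d))%N); first by apply: leq_sum => j _; exact: (DE _).2.
    by rewrite sum_nat_const card_ord mulnDr.
  by move=> /dvdnP[[|[|q]] E]; nia.
(* Powers of [u] permute the points, so each of the [r] steps contributes the same sum. This makes
   [n * n] a multiple of [r], whereas [n] is 1 modulo [r]. *)
have : (\sum_i S r i = r * \sum_i D i)%N.
  transitivity (\sum_(j < r) \sum_i D i)%N; last by rewrite sum_nat_const card_ord.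
  rewrite /S exchange_big; apply: eq_bigr => j _.
  by rewrite [RHS](reindex_inj (@perm_inj _ (u ^+ j))).
rewrite (eq_bigr (fun=> n)) // sum_nat_const card_ord => E.
have : r %| (n * n)%N by rewrite E dvdn_mulr.
have -> : (n * n = (d * n + d) * r + 1)%N by ring.
by rewrite dvdn_addr ?dvdn_mull // dvdn1; lia.
Qed.

Definition based : {set 'S_n} := [set w in periodic | (c ^+ d * w) ord0 == ord0].

Let dord : 'I_n := inord d.

Let dordE : dord = d :> nat.
Proof. by rewrite inordK // ltnS; nia. Qed.

Lemma cXd0 : (c ^+ d) ord0 = dord.
Proof. by apply: val_inj; rewrite cX_small ?dordE //=; nia. Qed.

Lemma basedP w : reflect (w \in periodic /\ w dord = ord0) (w \in based).
Proof.
rewrite [w \in based]in_set permM cXd0.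
by apply: (iffP andP) => -[wX /eqP w0].
Qed.

Lemma periodic_based w : w \in periodic -> exists j : 'I_n, w ^ (c ^+ j) \in based.
Proof.
move=> wX; have [i ui] := periodic_fixed wX.
have ji : (c ^+ (n - i)) i = ord0.
  by apply: val_inj; rewrite cXE subnKC ?modnn // ltnW.
exists (inord ((n - i) %% n)).
rewrite inordK ?ltn_mod // -(expg_mod _ (c_order N)) modn_mod (expg_mod _ (c_order N)).
by rewrite in_set periodicJ //= -ji turnJ ui.
Qed.

(** Powers of [c ^+ d * w] fix 0, so [twisted_power w m] sends [m * d] to 0. By [below_interval] it
    preserves the points up to [m * d], and so does its last factor, which is [w]. *)
Lemma based_stable w m : w \in based -> 0 < m <= r -> stable (fun x => x <= m * d) w.
Proof.
move=> /basedP[wX w0] /andP[m_gt0 mr].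
have md : m * d <= N by rewrite leq_mul2r mr orbT.
pose v : 'I_n := inord (m * d)%N; have vE : v = (m * d)%N :> nat by rewrite inordK.
have wm : twisted_power w m v = ord0.
  rewrite /twisted_power permM (_ : _ v = ord0); last first.
    by apply: (canLR (permK _)); apply: val_inj; rewrite cX_small ?vE /= (mulnC d).
  elim: (m) => [|k IH]; first by rewrite expg0 perm1.
  by rewrite expgSr permM IH permM cXd0 w0.
have := @below_interval _ _ v (below_twisted_power wX mr); rewrite wm vE => /(_ isT) st.
have := @reduced_twisted_power w m.-1 1 wX; rewrite addn1 prednK // muln1 => /(_ mr) red.
have E : twisted_power w m = twisted_power w m.-1 ^ (c ^+ d) * twisted_power w 1.
  by rewrite -{1}(prednK m_gt0) -(addn1 m.-1) twisted_powerD muln1.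
by rewrite E in st; have [_] := stable_reduced red st; rewrite twisted_power1.
Qed.

(** Turning by [d] moves a nonzero point into the next window, or from the last window to a point
    below [d]; the sets preserved by [w] keep it from coming back. *)
Lemma based_fixed w i : w \in based -> (c ^+ d * w) i = i -> i = ord0.
Proof.
move=> wB; rewrite permM; set x := (c ^+ d) i => wx; apply/val_inj/eqP/negPn/negP => /= i0.
have iN := ltn_ord i; have [idN|idN] := leqP (i + d) N.
  have xE : x = i + d :> nat by rewrite cX_small.
  have m_gt0 : 0 < x.-1 %/ d by rewrite divn_gt0 //; lia.
  have mr : x.-1 %/ d <= r by rewrite -ltnS ltn_divLR // mulSn; nia.
  have := stableC (based_stable wB (m := x.-1 %/ d) _); rewrite m_gt0 mr => /(_ isT x).
  have := leq_divM x.-1 d; have := ltn_ceil x.-1 d_gt0; rewrite /= wx mulSn.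
  by move: (x.-1 %/ d * d)%N => k; lia.
have dN : d + d <= N by nia.
have xE : x = i + d - n :> nat by rewrite cXE modn_wrap; [case: ifP|]; lia.
have := based_stable wB (m := 1) _; rewrite (ltnW r_ge2) mul1n => /(_ isT x).
by rewrite wx xE; lia.
Qed.

End PeriodicPermutations.

(** * Products of permutations with disjoint supports *)

Section DisjointProducts.
Variables (T : finType) (I : eqType) (F : I -> {perm T}).

Lemma prod_fixed (l : seq I) x : {in l, forall i, F i x = x} -> (\prod_(i <- l) F i) x = x.
Proof.
elim: l => [|i l IH] H; first by rewrite big_nil perm1.
rewrite big_cons permM H ?mem_head // IH // => k kl; apply: H.
by rewrite in_cons kl orbT.
Qed.

Lemma prod_disjoint (l : seq I) i x : uniq l -> i \in l ->
  (forall k, k != i -> F k x = x /\ F k (F i x) = F i x) ->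
  (\prod_(k <- l) F k) x = F i x.
Proof.
move=> + + H; elim: l => [//|k l IH] /= /andP[kl ul]; rewrite in_cons big_cons permM.
have [E _|ik /= il] := eqVneq i k.
  rewrite -E prod_fixed // => j jl; case: (H j) => //.
  by apply: contraNneq kl => ji; rewrite -E -ji.
by case: (H k) => [|-> _]; [rewrite eq_sym | exact: IH].
Qed.

Lemma abslen_prod_disjoint (l : seq I) (P : I -> pred T) : uniq l ->
  (forall i x, F i x != x -> P i x) ->
  (forall i k x, i != k -> P i x -> ~~ P k x) ->
  abslen (\prod_(i <- l) F i) = (\sum_(i <- l) abslen (F i))%N.
Proof.
move=> + FP PP; elim: l => [_|i l IH /= /andP[il ul]]; first by rewrite !big_nil abslen1.
rewrite prod_perm_cons big_cons -IH //; apply: (reduced_disjoint (FP i)) => x.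
apply: contraNN => Px; apply/eqP/prod_fixed => k kl; apply/eqP; apply: contraTT Px => /FP.
by apply: PP; apply: contraNneq il => <-.
Qed.

End DisjointProducts.

(** * Assembling a based permutation from its windows *)

Section BasedPermutations.
Variables (r d : nat).
Hypotheses (r_ge2 : 1 < r) (d_gt0 : 0 < d).
Notation N := (r * d)%N.
Notation n := N.+1.
Notation c := (full_cycle N).
Implicit Types (w a b : 'S_n) (x y : 'I_n) (s : {ffun 'I_r -> 'S_n}) (j : 'I_r).

Let dN : d + d <= N. Proof. by pnia. Qed.

Let dord : 'I_n := inord d.

Let dordE : dord = d :> nat.
Proof. by rewrite inordK // ltnS; plia. Qed.

Let r0 : 'I_r := Ordinal (ltnW r_ge2).

Lemma windowP x : x != ord0 -> exists j : 'I_r, j * d < x <= j * d + d.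
Proof.
rewrite -val_eqE /= => x0; have xN := ltn_ord x.
have jr : x.-1 %/ d < r by rewrite ltn_divLR //; plia.
exists (Ordinal jr) => /=; have := leq_divM x.-1 d; have := ltn_ceil x.-1 d_gt0.
by rewrite mulSn; move: (x.-1 %/ d * d)%N => k; plia.
Qed.

Lemma window_le (j : 'I_r) : j * d + d <= N.
Proof. by rewrite addnC -mulSn leq_mul2r ltn_ord orbT. Qed.

Definition block s (j : 'I_r) : 'S_n := s j ^ (c ^+ (j * d)).

(** The factors act on [1], ..., [d], and window [j] is that set shifted by [j * d]. The
    transposition acts first: it sends [d] to 0, as [basedP] demands, and joins 0 to the first
    window. *)
Definition assemble s : 'S_n := tperm ord0 dord * \prod_j block s j.

Section Assemble.
Variable s : {ffun 'I_r -> 'S_n}.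
Hypothesis s_supp : forall j x, s j x != x -> 0 < x <= d.

Let s_stable j : stable (fun x => 0 < x <= d) (s j).
Proof. exact/supp_stable/s_supp. Qed.

Lemma blockE j x y : 0 < x <= d -> y = x + j * d :> nat -> val (block s j y) = s j x + j * d.
Proof.
move=> xd yE; have jN := window_le j.
have -> : y = (c ^+ (j * d)) x by apply: val_inj; rewrite cX_small /= ?yE; plia.
rewrite permJ cX_small //; apply: leq_trans jN; rewrite addnC leq_add2l.
by case/andP: (s_stable j xd).
Qed.

Lemma block_supp j y : block s j y != y -> j * d < y <= j * d + d.
Proof.
have jN := window_le j.
rewrite -(permKV (c ^+ (j * d)) y); set x := _ y; rewrite permJ (inj_eq perm_inj) => /s_supp xd.
by rewrite cX_small; plia.
Qed.

Lemma block_disjoint (i j : 'I_r) x : i != j -> j * d < x <= j * d + d -> block s i x = x.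
Proof.
move=> ij xj; apply/eqP; apply: contraNT ij => /block_supp xi; apply/eqP/val_inj => /=.
by pnia.
Qed.

Lemma prod_blockE j x : j * d < x <= j * d + d -> (\prod_k block s k) x = block s j x.
Proof.
move=> xj; apply: prod_disjoint; rewrite ?index_enum_uniq ?mem_index_enum // => k kj.
rewrite !(block_disjoint kj) //; have [->//|] := eqVneq (block s j x) x.
by rewrite -(inj_eq (@perm_inj _ (block s j))) => /block_supp.
Qed.

Lemma prod_block0 : (\prod_k block s k) ord0 = ord0.
Proof. by apply: prod_fixed => j _; apply/eqP; apply: contraT => /block_supp; rewrite ltn0. Qed.

Lemma assemble_window j x : 0 < j -> j * d < x <= j * d + d -> assemble s x = block s j x.
Proof.
move=> j_gt0 xj; have jd : d <= j * d by rewrite leq_pmull.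
have x0 : ord0 != x by rewrite -val_eqE /=; plia.
have xd : dord != x by rewrite -val_eqE /= dordE; plia.
by rewrite permM tpermD // (prod_blockE xj).
Qed.

Lemma assemble_d : assemble s dord = ord0.
Proof. by rewrite permM tpermR prod_block0. Qed.

Lemma block0 x : block s r0 x = s r0 x.
Proof. by rewrite /block /= mul0n expg0 conjg1. Qed.

Lemma assemble_0 : assemble s ord0 = s r0 dord.
Proof. by rewrite permM tpermL (@prod_blockE r0) ?block0 // dordE /=; plia. Qed.

Lemma assemble_first y : 0 < y < d -> assemble s y = s r0 y.
Proof.
move=> yd; have y0 : ord0 != y by rewrite -val_eqE /=; plia.
have yd' : dord != y by rewrite -val_eqE /= dordE; plia.
by rewrite permM tpermD // (@prod_blockE r0) ?block0 //=; plia.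
Qed.

Lemma abslen_assemble : abslen (assemble s) = (\sum_j abslen (s j)).+1.
Proof.
rewrite /assemble tpermC abslen_tpermL_out; last first.
  by rewrite porbit_fixed ?prod_block0 // -val_eqE /= dordE; plia.
rewrite (@abslen_prod_disjoint _ _ _ _ (fun (j : 'I_r) x => j * d < x <= j * d + d)).
- by congr _.+1; apply: eq_bigr => j _; rewrite abslenJ.
- exact: index_enum_uniq.
- exact: block_supp.
- by move=> i j x; rewrite -val_eqE /= => ij; pnia.
Qed.

Let S k : 'S_n := if insub k is Some j then s j else 1.

Let SE (j : 'I_r) : S j = s j. Proof. by rewrite /S valK. Qed.

Let S_stable k : stable (fun x => 0 < x <= d) (S k).
Proof. by rewrite /S; case: insubP => [j _ _|_]; [exact: s_stable|exact: stable1]. Qed.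

Let pre k : 'S_n := \prod_(0 <= i < k) S i.

Let preS k y : pre k.+1 y = S k (pre k y).
Proof. by rewrite /pre big_nat_recr //= permM. Qed.

Let pre_stable k : stable (fun x => 0 < x <= d) (pre k).
Proof.
elim: k => [|k IH]; first by rewrite /pre big_nil; exact: stable1.
by move=> x /IH xd; rewrite preS; exact: S_stable.
Qed.

Let u := c ^+ d * assemble s.

(** Each application of [u] passes to the next window and applies the next factor there, so the
    partial products accumulate. *)
Let turn_pre k y : k < r -> 0 < y <= d -> val ((u ^+ k) (S 0 y)) = pre k.+1 y + k * d.
Proof.
move=> kr yd; elim: k kr => [|k IH] kr; first by rewrite expg0 perm1 addn0 preS /pre big_nil perm1.
have /IH {}IH := ltnW kr; rewrite expgSr permM; set z := _ (S 0 y) in IH *.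
have /andP[pd0 pdd] := pre_stable k.+1 yd; have := window_le (Ordinal kr) => /= kN.
have czE : (c ^+ d) z = pre k.+1 y + k.+1 * d :> nat.
  by rewrite [LHS]cX_small -[nat_of_ord z]/(val z) IH ?mulSn; plia.
rewrite permM (@assemble_window (Ordinal kr)) //=; last by rewrite czE; plia.
by rewrite (preS k.+1) (@blockE _ (pre k.+1 y)) -?(SE (Ordinal kr)) // pdd pd0.
Qed.

Hypothesis prod_s : \prod_j s j = cyc N 1 d.

Lemma assemble_turn : u ^+ r = 1.
Proof.
have pre_r : pre r = cyc N 1 d.
  by rewrite -prod_s /pre big_mkord; apply: eq_bigr => j _; rewrite SE.
have base y : 0 < y <= d -> (u ^+ r) (S 0 y) = S 0 y.
  move=> yd; have rE := ltn_predK r_ge2; have r1 : r.-1 < r by rewrite rE.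
  have := turn_pre r1 yd; rewrite rE pre_r => E.
  have -> : u ^+ r = u ^+ r.-1 * u by rewrite -expgSr rE.
  rewrite permM.
  set z := _ (S 0 y) in E *; rewrite permM.
  have C := @cycE N 1 d y; rewrite /= in C.
  have rd : (r.-1 * d + d = N)%N by rewrite addnC -mulSn rE.
  (* After [r - 1] steps the last window holds the image of [y] under [cyc N 1 d]. Wrapping around
     modulo [N + 1] subtracts 1, which undoes that cycle except that [y = d] lands on 0, where
     [assemble] takes the value of its first factor at [d]. *)
  have czE : (c ^+ d) z = (if y < d then y : nat else 0)%N :> nat.
    rewrite [LHS]cXE -[nat_of_ord z]/(val z) E [nat_of_ord (cyc _ _ _ _)]C; last plia.
    rewrite modn_wrap; last by do ?case: ifP; plia.
    by do ?case: ifP; plia.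
  rewrite (SE r0); move: czE; case: ltnP => [y_lt|y_ge] czE.
    by rewrite (_ : _ z = y) ?assemble_first //; [plia|exact: val_inj].
  rewrite (_ : _ z = ord0) ?assemble_0; last exact: val_inj.
  by congr (s r0 _); apply: val_inj; rewrite /= dordE; plia.
apply/permP => z; rewrite perm1; have [->|/windowP[j zj]] := eqVneq z ord0.
  have u0 : u ord0 = ord0 by rewrite permM cXd0 // assemble_d.
  exact: permX_fix.
have jN := window_le j; pose z' : 'I_n := inord (z - j * d).
have z'E : z' = z - j * d :> nat by rewrite inordK //; have := ltn_ord z; plia.
have yd : 0 < (pre j.+1)^-1 z' <= d by apply: (stableV (@pre_stable j.+1)); rewrite z'E; plia.
(* Every nonzero point is on the orbit of a point of the first window. *)
have -> : z = (u ^+ j) (S 0 ((pre j.+1)^-1 z')).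
  by apply: val_inj; rewrite turn_pre // permKV z'E /= subnK //; plia.
by rewrite -permM -expgD addnC expgD permM base.
Qed.

End Assemble.

End BasedPermutations.

Lemma prod_first (gT : groupType) m (i0 : 'I_m) x (F : 'I_m -> gT) : i0 = 0 :> nat ->
  \prod_j (if j == i0 then x else F j) = x * \prod_j (if j == i0 then 1 else F j).
Proof.
case: m i0 F => [[]//|m] i0 F i00; have -> : i0 = ord0 by exact: val_inj.
rewrite !big_ord_recl !eqxx mul1g; congr (_ * _).
Qed.

(** * Counting the periodic permutations *)

Section CountPeriodic.
Variables (r d : nat).
Hypotheses (r_ge2 : 1 < r) (d_gt0 : 0 < d).
Notation N := (r * d)%N.
Notation n := N.+1.
Notation c := (full_cycle N).
Implicit Types (w a b : 'S_n) (x y : 'I_n) (s : {ffun 'I_r -> 'S_n}) (j : 'I_r).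

Let dN : d + d <= N. Proof. by nia. Qed.

Let dord : 'I_n := inord d.

Let dordE : dord = d :> nat.
Proof. by rewrite inordK // ltnS; lia. Qed.

Let r0 : 'I_r := Ordinal (ltnW r_ge2).

(** From a point of the first window, [r - 1] turns pass through the other windows, where [w] and
    [w'] agree. The next turn must close the orbit, and this determines the remaining values. *)
Lemma based_unique w w' : (c ^+ d * w) ^+ r = 1 -> (c ^+ d * w') ^+ r = 1 ->
  w dord = ord0 -> w' dord = ord0 ->
  (forall m, 0 < m <= r -> stable (fun x => x <= m * d) w) ->
  (forall x, d < x -> w x = w' x) -> w = w'.
Proof.
set u := c ^+ d * w; set u' := c ^+ d * w'; move=> ur ur' wd wd' st ww'.
have iter x k : 0 < x <= d -> k < r ->
    (u ^+ k) x = (u' ^+ k) x /\ k * d < (u ^+ k) x <= k * d + d.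
  move=> xd; elim: k => [|k IH] kr; first by rewrite !expg0 perm1; split=> //; plia.
  have [E zk] := IH (ltnW kr); rewrite !expgSr !permM -E; set z := _ x in zk *.
  have kN := window_le d (Ordinal kr); rewrite /= in kN.
  have czE : (c ^+ d) z = z + d :> nat by rewrite [LHS]cX_small; plia.
  split; first by rewrite ww' // czE; plia.
  have := st k.+2; rewrite /= kr => /(_ isT ((c ^+ d) z)).
  have := stableC (st k.+1 (ltnW kr)) => /(_ ((c ^+ d) z)).
  by rewrite /= czE; plia.
apply/permP => q; have [qd|qd] := ltnP d q; first exact: ww'.
have [->|qd'] := eqVneq q dord; first by rewrite wd wd'.
have wq : 0 < w q <= d.
  have := st 1%N (ltnW r_ge2) q; rewrite mul1n => /(_ qd) ->; rewrite andbT lt0n.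
  by apply: contraNneq qd' => wq; apply/eqP/(@perm_inj _ w); rewrite wd; exact: val_inj.
have r1 : r.-1 < r by rewrite (ltn_predK r_ge2).
have uS (v : 'S_n) : v ^+ r = v ^+ r.-1 * v by rewrite -expgSr (ltn_predK r_ge2).
have [E _] := iter (w q) r.-1 wq r1.
have /permP/(_ (w q)) := ur; rewrite uS perm1 permM [X in X = _]permM => /perm_inj cq.
by have /permP/(_ (w q)) := ur'; rewrite uS perm1 permM -E permM cq.
Qed.

Lemma minfact_cyc_supp s : s \in minfact r (cyc N 1 d) -> forall j x, s j x != x -> 0 < x <= d.
Proof.
move=> sF; apply: (minfact_supp sF) => x.
by apply: contraNT => xd; rewrite cyc_out.
Qed.

Lemma assemble_based s : s \in minfact r (cyc N 1 d) -> assemble s \in based r d.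
Proof.
move=> sF; have ss := minfact_cyc_supp sF; have [sp sl] := minfactP _ _ sF.
apply/basedP => //; split; last exact: assemble_d.
apply/periodicP; split; last exact: assemble_turn.
by rewrite abslen_assemble // sl abslen_cyc ?subn1 ?prednK //; lia.
Qed.

Lemma based_assemble w : w \in based r d -> exists2 s, s \in minfact r (cyc N 1 d) & assemble s = w.
Proof.
move=> wB; have [wX wd] := basedP r_ge2 d_gt0 _ wB; have [wl wr] := periodicP _ wX.
have st := based_stable r_ge2 d_gt0 wB.
pose C := cyc N 1 d; pose P j := fun x : 'I_n => j * d < x <= j * d + d.
pose f j := restr (P j) w ^ (c ^+ (j * d))^-1.
pose Q := \prod_j (if j == r0 then 1 else f j).
(* Beyond the first window the factors are read off from [w]. The factor of index 0 is the one that
   makes the product [C]; [based_unique] shows that it is consistent with [w]. *)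
pose s : {ffun 'I_r -> 'S_n} := [ffun j => if j == r0 then C * Q^-1 else f j].
have PS j : j != r0 -> stable (P j) w.
  rewrite -val_eqE /= => j0 x xj; have jr := ltn_ord j.
  have /(_ _ x) H1 := stableC (st j _).
  have /(_ _ x) H2 := st j.+1; move: H1 H2; rewrite /= /P in xj *; rewrite lt0n j0 (ltnW jr) jr.
  by move=> /(_ isT) H1 /(_ isT) H2; plia.
have f_supp j x : f j x != x -> 0 < x <= d.
  rewrite -{1 2}(permKV ((c ^+ (j * d))^-1) x) permJ (inj_eq perm_inj) => /restr_supp.
  rewrite /P invgK => H; have := ltn_ord x; have := window_le d j => jN xN.
  have [xN'|xN'] := leqP (x + j * d) N; first by rewrite cX_small in H; plia.
  by rewrite cXE modn_wrap in H; [case: ifP H|]; plia.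
have C_supp x : C x != x -> 0 < x <= d by apply: contraNT => xd; rewrite cyc_out.
have s_supp j x : s j x != x -> 0 < x <= d.
  rewrite ffunE; case: ifP => _; last exact: f_supp.
  apply: contraNT => xd; have Qx : Q x = x.
    apply: prod_fixed => j' _; case: ifP => _; first by rewrite perm1.
    by apply/eqP; apply: contraNT xd; exact: f_supp.
  have /eqP Cx : C x == x by apply: contraNT xd; exact: C_supp.
  by rewrite permM Cx -{1}Qx permK.
have sp : \prod_j s j = C.
  rewrite (eq_bigr (fun j => if j == r0 then C * Q^-1 else f j)); last first.
    by move=> j _; rewrite ffunE.
  by rewrite (prod_first (i0 := r0)) // mulgKV.
have aw : assemble s = w.
  apply/esym/based_unique => //.
  - exact: assemble_turn.
  - exact: assemble_d.
  move=> x xd; have [|j xj] := windowP r_ge2 d_gt0 (x := x); first by rewrite -val_eqE /=; plia.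
  have j0 : j != r0 by rewrite -val_eqE /=; apply: contraTneq xj => ->; plia.
  rewrite (@assemble_window _ _ r_ge2 d_gt0 _ s_supp j) //; last by rewrite lt0n.
  by rewrite /block ffunE (negPf j0) /f conjgKV restrE //; exact: PS.
exists s => //; rewrite in_minfact sp eqxx /= abslen_cyc; last by plia.
by rewrite -ltnS -(abslen_assemble r_ge2 d_gt0 s_supp) aw wl subn1 prednK.
Qed.

Lemma assemble_inj : {in minfact r (cyc N 1 d) &, injective (@assemble r d)}.
Proof.
move=> s s' sF sF' E; have ss := minfact_cyc_supp sF; have ss' := minfact_cyc_supp sF'.
apply/ffunP => j; apply/permP => x.
have [xd|xd] := boolP (0 < x <= d); last first.
  by rewrite (minfact_fix sF) ?(minfact_fix sF') // cyc_out.
apply: val_inj; have [->|j0] := eqVneq j r0.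
  have [xd'|xd'] := eqVneq (x : nat) d.
    have -> : x = dord by apply: val_inj; rewrite /= dordE.
    by rewrite -!(assemble_0 r_ge2 d_gt0) // E.
  by rewrite -!(assemble_first r_ge2 d_gt0) ?E //; plia.
have jN := window_le d j; pose y : 'I_n := inord (x + j * d).
have yE : y = x + j * d :> nat by rewrite inordK //; plia.
have j_gt0 : 0 < j by rewrite lt0n.
apply/eqP; rewrite -(eqn_add2r (j * d)) -(blockE r_ge2 d_gt0 ss xd yE) -(blockE r_ge2 d_gt0 ss' xd yE).
by rewrite -!(assemble_window r_ge2 d_gt0) ?E //; plia.
Qed.

Lemma card_based : #|based r d| = #|minfact r (cyc N 1 d)|.
Proof.
rewrite -(card_in_imset assemble_inj); apply: eq_card => w.
apply/idP/imsetP => [/based_assemble[s sF <-]|[s sF ->]]; first by exists s.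
exact: assemble_based.
Qed.

(** Rotating a based permutation by [j] moves the fixed point of [c ^+ d * w] from 0 to [j]; that
    fixed point is unique by [based_fixed], so [j] can be recovered. *)
Lemma card_periodic : #|periodic r d| = (n * #|based r d|)%N.
Proof.
transitivity #|setX [set: 'I_n] (based r d)|; last by rewrite cardsX cardsT card_ord.
pose f (u : 'I_n * 'S_n) := u.2 ^ (c ^+ u.1).
have c0 (k : 'I_n) : (c ^+ k) ord0 = k.
  by have kN := ltn_ord k; apply: val_inj; rewrite cX_small.
rewrite -(@card_in_imset _ _ f).
  apply: eq_card => w; apply/idP/imsetP => [wX|[[j w'] /setXP[_ /=]]].
    have [j wB] := periodic_based r_ge2 d_gt0 wX.
    exists (inord ((n - j) %% n), w ^ (c ^+ j)); first by rewrite in_setX in_setT.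
    rewrite /f /= inordK ?ltn_mod // (expg_mod _ (c_order N)) -conjgM -expgD.
    by rewrite subnKC ?c_order ?conjg1 // ltnW.
  by rewrite in_set => /andP[wX _] ->; exact: periodicJ.
move=> [j w] [j' w'] /setXP[_ wB] /setXP[_ wB'] E.
rewrite /f /= in wB wB' E.
have fixd (v : 'S_n) (k : 'I_n) : v \in based r d -> (c ^+ d * v ^ (c ^+ k)) k = k.
  rewrite in_set => /andP[_ /eqP v0].
  by rewrite -{2 3}(c0 k) turnJ v0.
have jj : j = j'.
  have H := fixd w' j' wB'; rewrite -E in H.
  pose i := (c ^+ j)^-1 j'; have ij : j' = (c ^+ j) i by rewrite permKV.
  rewrite {1 2}ij turnJ in H; move/perm_inj: H => /(based_fixed r_ge2 d_gt0 wB) i0.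
  by rewrite ij i0 c0.
by rewrite jj in E *; move/conjg_inj: E => ->.
Qed.

End CountPeriodic.

(** * Merging the windows into the first one *)

Section Merging.
Variables (r d : nat).
Hypotheses (r_ge2 : 1 < r) (d_gt0 : 0 < d).
Notation N := (r * d)%N.
Notation n := N.+1.
Notation c := (full_cycle N).
Implicit Types (w a b : 'S_n) (x y : 'I_n) (s : {ffun 'I_r -> 'S_n}) (j : 'I_r).

Let dN : d + d <= N. Proof. by nia. Qed.

Let dord : 'I_n := inord d.

Let dordE : dord = d :> nat.
Proof. by rewrite inordK // ltnS; lia. Qed.

Let r0 : 'I_r := Ordinal (ltnW r_ge2).

(** It is assembled from the factorization that puts the whole cycle in the factor of index 0. *)
Lemma based_cyc : cyc N 0 d \in based r d.
Proof.
pose s : {ffun 'I_r -> 'S_n} := [ffun j => if j == r0 then cyc N 1 d else 1].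
have sF : s \in minfact r (cyc N 1 d).
  rewrite in_minfact (eq_bigr (fun j => if j == r0 then cyc N 1 d else 1)); last first.
    by move=> j _; rewrite ffunE.
  rewrite (prod_first (i0 := r0)) // big1 ?mulg1 ?eqxx /=; last by move=> j _; rewrite if_same.
  rewrite (bigD1 r0) //= big1 ?addn0 ?ffunE ?eqxx // => j /negPf j0.
  by rewrite ffunE j0 abslen1.
rewrite (_ : cyc N 0 d = assemble s); first exact: assemble_based.
have ss := minfact_cyc_supp sF; apply/permP => x; apply: val_inj; rewrite cycE /=; last by plia.
have s0 : s r0 = cyc N 1 d by rewrite ffunE eqxx.
case: (ltngtP x d) => xd.
- have [x0|x0] := eqVneq x ord0.
    rewrite x0 (assemble_0 r_ge2 d_gt0 ss) -/r0 s0 [RHS]cycE -/dord ?dordE; last by plia.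
    by rewrite /= eqxx; case: ifP; plia.
  have x0' : 0 < x by rewrite lt0n; exact: x0.
  rewrite (assemble_first r_ge2 d_gt0 ss) -/r0 ?s0 ?[RHS]cycE; try plia.
  by do ?case: ifP; plia.
- have [|j xj] := windowP r_ge2 d_gt0 (x := x); first by rewrite -val_eqE /=; plia.
  have j0 : j != r0 by rewrite -val_eqE /=; apply: contraTneq xj => ->; plia.
  rewrite (assemble_window r_ge2 d_gt0 ss (j := j)) //; last by rewrite lt0n.
  by rewrite /block ffunE (negPf j0) conj1g perm1.
- have -> : x = dord by apply: val_inj; rewrite /= dordE.
  by rewrite (assemble_d r_ge2 d_gt0 ss).
Qed.

Lemma based_first w : w \in based r d -> (forall x, d < x -> w x = x) -> w = cyc N 0 d.
Proof.
move=> wB wx; have [wX wd] := basedP r_ge2 d_gt0 _ wB.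
have [cX cd] := basedP r_ge2 d_gt0 _ based_cyc.
apply: (based_unique r_ge2 d_gt0) => //.
- by case/periodicP: wX.
- by case/periodicP: cX.
- by move=> m mr; exact: (based_stable r_ge2 d_gt0 wB).
by move=> x xd; rewrite wx // cyc_out //; plia.
Qed.

(** Multiplied by [c ^+ d], the new product is a conjugate of the old one, so its [r]-th power is 1.
    By [periodic_abslen_ge] its length cannot fall below [d], hence it is reduced. *)
Lemma periodic_merge a b : reduced b a -> b * a \in periodic r d ->
  a * b ^ (c ^+ d)^-1 \in periodic r d /\ reduced a (b ^ (c ^+ d)^-1).
Proof.
move=> red /periodicP[l ur]; set b' := b ^ _.
have ur' : (c ^+ d * (a * b')) ^+ r = 1.
  have -> : c ^+ d * (a * b') = (c ^+ d * (b * a)) ^ (a^-1 * (c ^+ d)^-1).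
    by rewrite /b' /conjg !invMg !invgK !mulgA mulgK.
  by rewrite -conjXg ur conj1g.
have H1 := periodic_abslen_ge r_ge2 d_gt0 ur'; have H2 := abslenM_le a b'.
have H3 : abslen b' = abslen b := abslenJ _ _.
rewrite red in l.
have H4 : abslen (a * b') = d by rewrite H3 in H2; plia.
split; first exact/periodicP.
by rewrite /reduced [LHS]H4 -[LHS]l H3 addnC.
Qed.

(** Take for [a] the action on the points up to [d] and for [b] the rest. Shifting [b] back by [d]
    lowers each of its windows by one place, the lowest onto the first window. *)
Lemma based_merge w m : w \in based r d -> 0 < m < r -> (forall x, m.+1 * d < x -> w x = x) ->
  exists a b, [/\ w = b * a, reduced b a, a * b ^ (c ^+ d)^-1 \in based r d,
    reduced a (b ^ (c ^+ d)^-1) & forall x, m * d < x -> (a * b ^ (c ^+ d)^-1) x = x].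
Proof.
move=> wB /andP[m_gt0 mr] wx; have [wX wd] := basedP r_ge2 d_gt0 _ wB.
have st := based_stable r_ge2 d_gt0 wB (m := 1); rewrite mul1n in st.
have {}st : stable (fun x => x <= d) w by apply: st; exact: ltnW.
pose P := fun x : 'I_n => x <= d; pose a := restr P w; pose b := restr (predC P) w.
have aP x : a x != x -> P x by exact: restr_supp.
have bP x : b x != x -> ~~ P x by exact: restr_supp.
have ab : commute a b := disjoint_commute aP bP.
have wE : w = b * a by rewrite -ab restr_mulC.
have red : reduced b a.
  by have := reduced_disjoint aP bP; rewrite /reduced ab addnC.
have [w'X red'] : a * b ^ (c ^+ d)^-1 \in periodic r d /\ reduced a (b ^ (c ^+ d)^-1).
  by apply: periodic_merge => //; rewrite -wE.
have md : m.+1 * d <= N by rewrite leq_mul2r mr orbT.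
have b'x y : b ((c ^+ d) y) = (c ^+ d) y -> (b ^ (c ^+ d)^-1) y = y.
  by move=> H; rewrite -{1}(permK (c ^+ d) y) permJ H permK.
have bx x : ~~ (d < x <= m.+1 * d) -> b x = x.
  move=> H; have [Px|Px] := boolP (P x); first by rewrite /b restr_out //= negbK.
  by rewrite /b (restrE (stableC st)) // wx // ltnNge; apply: contra H => ->; rewrite andbT ltnNge.
exists a, b; split=> //.
  apply/basedP => //; split=> //; rewrite permM.
  have -> : a dord = ord0 by rewrite /a restrE // /P dordE.
  by apply: b'x; rewrite cXd0 // bx // dordE; plia.
move=> x xm; rewrite permM; have -> : a x = x.
  by apply: restr_out; rewrite /P -ltnNge; apply: leq_trans xm; rewrite ltnS leq_pmull.
apply: b'x; apply: bx; rewrite cXE; have xN := ltn_ord x.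
have [xN'|xN'] := leqP (x + d) N; first by rewrite modn_small //= mulSn; plia.
by rewrite modn_wrap; [case: ifP|]; plia.
Qed.

End Merging.

(** * The braid group and its band generators *)

Section BraidGroup.
Variable n : nat.
Local Open Scope nat_scope.

(* Erasing the letters that are not generators makes every word invertible, so that the quotient
   of all words is a group; on valid words the relation is [beq n]. *)
Definition trim (w : word) : word := [seq l <- w | 0 < l.1 < n].

Definition braid_rel : rel word := fun u v => `[< beq n (trim u) (trim v) >].

Lemma braid_rel_equiv : equiv_class_of braid_rel.
Proof.
split=> [u|u v|v u w].
- by apply/asboolP; exact: beq_refl.
- by apply/asboolP/asboolP; exact: beq_sym.
- by move=> /asboolP uv /asboolP vw; apply/asboolP; exact: beq_trans uv vw.
Qed.

Canonical braid_equiv := EquivRelPack braid_rel_equiv.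

Definition braid := {eq_quot braid_equiv}%qT.

HB.instance Definition _ := Choice.on braid.

Definition br (w : word) : braid := (\pi_braid w)%qT.

Lemma brP u v : br u = br v <-> beq n (trim u) (trim v).
Proof. by split=> [/eqP|uv]; [|apply/eqP]; rewrite /br eqmodE => //; [move/asboolP|apply/asboolP]. Qed.

Definition rep (g : braid) : word := generic_quotient.repr g.

Lemma br_repK g : br (rep g) = g. Proof. exact: reprK. Qed.

Lemma rep_br w : beq n (trim (rep (br w))) (trim w).
Proof. by apply/brP; rewrite br_repK. Qed.

Lemma beq_cat u u' v v' : beq n u u' -> beq n v v' -> beq n (u ++ v) (u' ++ v').
Proof.
move=> uu' vv'; apply: beq_trans (_ : beq n (u ++ v) (u' ++ v)) _.
  exact: (beq_ctx [::] v uu').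
by have := beq_ctx u' [::] vv'; rewrite !cats0.
Qed.

Lemma winv_cat u v : winv (u ++ v) = winv v ++ winv u.
Proof. by rewrite /winv map_cat rev_cat. Qed.

Lemma winvK : involutive winv.
Proof.
move=> w; rewrite /winv map_rev revK -map_comp map_id_in // => -[i b] _ /=.
by rewrite negbK.
Qed.

Lemma valid_winv w : valid n (winv w) = valid n w.
Proof. by rewrite /valid /winv all_rev all_map. Qed.

Lemma valid_cat u v : valid n (u ++ v) = valid n u && valid n v.
Proof. exact: all_cat. Qed.

Lemma beq_mulV w : valid n w -> beq n (w ++ winv w) [::].
Proof.
elim: w => [|[i b] w IH]; first by move=> _; exact: beq_refl.
rewrite /= => /andP[ib /IH {}IH].
have -> : (i, b) :: w ++ winv ((i, b) :: w) = [:: (i, b)] ++ (w ++ winv w) ++ [:: (i, ~~ b)].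
  by rewrite (winv_cat [:: (i, b)] w) /= catA.
apply: beq_trans (beq_ctx _ _ IH) _.
exact: beq_free.
Qed.

Lemma beq_Vmul w : valid n w -> beq n (winv w ++ w) [::].
Proof. by move=> vw; rewrite -{2}(winvK w); apply: beq_mulV; rewrite valid_winv. Qed.

Lemma trim_cat u v : trim (u ++ v) = trim u ++ trim v.
Proof. exact: filter_cat. Qed.

Lemma trim_winv u : trim (winv u) = winv (trim u).
Proof. by rewrite /trim /winv filter_rev filter_map. Qed.

Lemma valid_trim u : valid n (trim u).
Proof. exact: filter_all. Qed.

Lemma trim_valid u : valid n u -> trim u = u.
Proof. by move/all_filterP. Qed.

Lemma beq_winv u v : valid n u -> valid n v -> beq n u v -> beq n (winv u) (winv v).
Proof.
move=> vu vv uv; apply: (@beq_trans _ _ (winv u ++ v ++ winv v)).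
  by apply: beq_sym; rewrite -{2}(cats0 (winv u)); apply: beq_cat (beq_refl _ _) (beq_mulV vv).
rewrite catA -{2}(cat0s (winv v)); apply: beq_cat (beq_refl _ _).
apply: beq_trans (_ : beq n _ (winv u ++ u)) (beq_Vmul vu).
exact: beq_cat (beq_refl _ _) (beq_sym uv).
Qed.

Definition brmul (g h : braid) : braid := br (rep g ++ rep h).
Definition brone : braid := br [::].
Definition brinv (g : braid) : braid := br (winv (rep g)).

Lemma brM_subproof u v : brmul (br u) (br v) = br (u ++ v).
Proof. by apply/brP; rewrite !trim_cat; apply: beq_cat; exact: rep_br. Qed.

Lemma brV_subproof u : brinv (br u) = br (winv u).
Proof. by apply/brP; rewrite !trim_winv; apply: beq_winv; rewrite ?valid_trim //; exact: rep_br. Qed.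

Lemma brmulA : associative brmul.
Proof.
by move=> g h k; rewrite -(br_repK g) -(br_repK h) -(br_repK k) !brM_subproof catA.
Qed.

Lemma brmul1g : left_id brone brmul.
Proof. by move=> g; rewrite -(br_repK g) brM_subproof. Qed.

Lemma brmulg1 : right_id brone brmul.
Proof. by move=> g; rewrite -(br_repK g) brM_subproof cats0. Qed.

Lemma brmulVg : left_inverse brone brinv brmul.
Proof.
move=> g; rewrite -(br_repK g) brV_subproof brM_subproof; apply/brP.
by rewrite trim_cat trim_winv; apply: beq_Vmul; exact: valid_trim.
Qed.

Lemma brmulgV : right_inverse brone brinv brmul.
Proof.
move=> g; rewrite -(br_repK g) brV_subproof brM_subproof; apply/brP.
by rewrite trim_cat trim_winv; apply: beq_mulV; exact: valid_trim.
Qed.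

HB.instance Definition _ := isGroup.Build braid brmulA brmul1g brmulg1 brmulVg brmulgV.

End BraidGroup.

Section BraidGroupTheory.
Variable n : nat.
Implicit Types (u v w : word) (g h : braid n).

Lemma brM u v : br n (u ++ v) = br n u * br n v.
Proof. by rewrite -brM_subproof. Qed.

Lemma brV u : br n (winv u) = (br n u)^-1.
Proof. by rewrite -brV_subproof. Qed.

Lemma br1 : br n [::] = 1. Proof. by []. Qed.

Lemma br_beq u v : valid n u -> valid n v -> beq n u v <-> br n u = br n v.
Proof. by move=> vu vv; rewrite brP !trim_valid. Qed.

End BraidGroupTheory.

(** * Relations between the band generators *)

Section BandRelations.
Variable n : nat.
Notation B := (braid n).

Definition sigma k : B := br n [:: (k, true)].
Definition band_br i j : B := br n (band i j).

Lemma sigmaV k : br n [:: (k, false)] = (sigma k)^-1.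
Proof. by rewrite -brV. Qed.

Lemma sigma_comm i j : 0 < i < n -> 0 < j < n -> i.+1 < j -> commute (sigma i) (sigma j).
Proof.
move=> i_n j_n ij; rewrite /commute /sigma -!brM; apply/brP.
by rewrite !trim_valid ?/valid /= ?i_n ?j_n //; exact: beq_comm.
Qed.

Lemma sigma_braid i : 0 < i -> i.+1 < n ->
  sigma i * sigma i.+1 * sigma i = sigma i.+1 * sigma i * sigma i.+1.
Proof.
move=> i_gt0 i_n; rewrite /sigma -!brM; apply/brP; rewrite !trim_valid ?/valid /= ?i_gt0 ?i_n ?(ltnW i_n) //.
exact: beq_braid.
Qed.

Lemma band1 j : band_br j.+1 j = sigma j.
Proof. by rewrite /band_br /band subnn. Qed.

Lemma bandS i j : j < i -> band_br i.+1 j = sigma i * band_br i j * (sigma i)^-1.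
Proof.
move=> ji; rewrite /band_br -sigmaV /sigma -!brM /band (_ : i.+1 - j.+1 = i - j.+1 + 1)%N; last lia.
by rewrite iotaD rev_cat !map_cat /= subnKC // -!catA.
Qed.

Lemma bandSJ i j : j < i -> band_br i.+1 j = band_br i j ^ (sigma i)^-1.
Proof. by move=> /bandS ->; rewrite /conjg invgK mulgA. Qed.

Lemma commuteJ (gT : groupType) (x y z : gT) : commute x y -> commute x z -> commute x (y ^ z^-1).
Proof.
by move=> xy xz; rewrite /conjg invgK; apply: commuteM => //; apply: commuteM => //; apply: commuteV.
Qed.

Lemma sigma_band_far m i j : 0 < m < n -> 0 < j < i -> i <= n -> (m.+1 < j) || (i < m) ->
  commute (sigma m) (band_br i j).
Proof.
move=> mn /andP[j0]; elim: i => [//|i IH]; rewrite ltnS leq_eqVlt => /predU1P[<-|ji] i_n far.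
  rewrite band1; case/orP: far => far; last apply: commute_sym; apply: sigma_comm; lia.
rewrite bandSJ //; apply: commuteJ; first by apply: IH; lia.
by case/orP: far => far; last apply: commute_sym; apply: sigma_comm; lia.
Qed.

(** By the braid relation [a] is [b] conjugated by [(b * a)^-1]; the other element is [x] conjugated
    by the same. *)
Lemma commute_braid (gT : groupType) (x a b : gT) : a * b * a = b * a * b -> commute x b ->
  commute a ((x ^ a^-1) ^ b^-1).
Proof.
move=> ab xb; rewrite /commute /conjg !invgK; apply: (mulIg (b * a)).
rewrite !mulgA !mulgKV -!mulgA (mulgA a b a) ab !mulgA mulgKV mulgKV.
by rewrite -(mulgA (b * a) x) xb !mulgA ab.
Qed.

Lemma sigma_band_inside m i j : 0 < j < m -> m.+1 < i -> i <= n -> commute (sigma m) (band_br i j).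
Proof.
move=> /andP[j0 jm]; elim: i => [//|i IH]; rewrite ltnS leq_eqVlt => /predU1P[<-|mi] i_n.
  rewrite bandSJ; last by lia.
  rewrite bandSJ //; apply: commute_braid; first by apply: sigma_braid; lia.
  by apply/commute_sym/sigma_band_far; lia.
rewrite bandSJ; last by lia.
apply: commuteJ; first by apply: IH; lia.
by apply: sigma_comm; lia.
Qed.

Lemma commute_band x i j : 0 < j < i -> (forall m, j <= m < i -> commute x (sigma m)) ->
  commute x (band_br i j).
Proof.
move=> /andP[j0]; elim: i => [//|i IH]; rewrite ltnS leq_eqVlt => /predU1P[<-|ji] H.
  by rewrite band1; apply: H; lia.
by rewrite bandSJ //; apply: commuteJ; [apply: IH => // m mi; apply: H; lia|apply: H; lia].
Qed.

Lemma band_separated i j k l : 0 < j < i -> i < l -> l < k <= n -> commute (band_br i j) (band_br k l).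
Proof.
move=> ji il lk; apply: commute_band => [|m mk]; first by lia.
by apply/commute_sym/sigma_band_far; lia.
Qed.

Lemma band_nested i j k l : 0 < l < j -> j < i -> i < k <= n -> commute (band_br i j) (band_br k l).
Proof.
move=> lj ji ik; apply/commute_sym; apply: commute_band => [|m mk]; first by lia.
by apply/commute_sym/sigma_band_inside; lia.
Qed.

(** By induction [band_br s.+1 j] is [sigma s] conjugated by [band_br s j], which commutes with
    [sigma s.+1]; the claim is thus a conjugate of the relation between [sigma s] and
    [sigma s.+1]. *)
Lemma band_braid s j : 0 < j < s -> s < n ->
  sigma s * band_br s j * sigma s = band_br s j * sigma s * band_br s j.
Proof.
move=> /andP[j0]; elim: s => [//|s IH]; rewrite ltnS leq_eqVlt => /predU1P[<-|js] s_n.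
  by rewrite band1 sigma_braid //; lia.
have {}IH := IH js (ltnW s_n); set x := band_br s j in IH.
have -> : band_br s.+1 j = sigma s ^ x.
  by rewrite bandS // -/x; apply: (mulIg (sigma s)); rewrite mulgKV /conjg mulgA -(mulgA x^-1);
    apply: (mulgI x); rewrite !mulgA mulgV mul1g.
have xs : sigma s.+1 = sigma s.+1 ^ x.
  by rewrite /conjg (_ : sigma s.+1 * x = x * sigma s.+1) ?mulKg //; apply: sigma_band_far; lia.
by rewrite xs -!conjMg sigma_braid //; lia.
Qed.

(** Together with [band_chain_r] this is the triangle relation of the Birman-Ko-Lee presentation:
    the three products of two sides, in the right cyclic sense, agree. *)
Lemma band_chain_l t s j : 0 < j < s -> s < t <= n ->
  band_br t j * band_br t s = band_br t s * band_br s j.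
Proof.
move=> js; elim: t => [//|t IH]; rewrite ltnS leq_eqVlt => /andP[/predU1P[<-|st] t_n].
  by rewrite band1 bandS ?mulgKV //; lia.
rewrite !bandSJ //; last by lia.
have C : band_br s j = band_br s j ^ (sigma t)^-1.
  rewrite /conjg invgK mulgA (_ : sigma t * band_br s j = band_br s j * sigma t) ?mulgK //.
  by apply: sigma_band_far; lia.
by rewrite {1}C -!conjMg IH //; lia.
Qed.

Lemma band_chain_r t s j : 0 < j < s -> s < t <= n ->
  band_br t s * band_br s j = band_br s j * band_br t j.
Proof.
move=> js; elim: t => [//|t IH]; rewrite ltnS leq_eqVlt => /andP[/predU1P[<-|st] t_n].
  rewrite band1 bandS; last by lia.
  by apply: (mulIg (sigma s)); rewrite !mulgA mulgKV band_braid //; lia.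
rewrite !bandSJ //; last by lia.
have C : band_br s j = band_br s j ^ (sigma t)^-1.
  rewrite /conjg invgK mulgA (_ : sigma t * band_br s j = band_br s j * sigma t) ?mulgK //.
  by apply: sigma_band_far; lia.
by rewrite {1 2}C -!conjMg IH //; lia.
Qed.

End BandRelations.

(** * The permutation and the exponent sum of a braid *)

Section Morphisms.
Variable N : nat.
Notation n := N.+1.
Notation B := (braid n).

(** Strands are numbered from 1 in words but from 0 in ['I_n], hence the shift. *)
Definition letter_perm (l : letter) : 'S_n := tperm (inord l.1.-1) (inord l.1).

Definition word_perm (w : word) : 'S_n := \prod_(l <- trim n w) letter_perm l.

Definition word_exp (w : word) : int := (\sum_(l <- trim n w) (if l.2 then 1 else -1))%R.

Lemma word_permM u v : word_perm (u ++ v) = word_perm u * word_perm v.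
Proof. by rewrite /word_perm trim_cat big_cat. Qed.

Lemma word_expM u v : word_exp (u ++ v) = (word_exp u + word_exp v)%R.
Proof. by rewrite /word_exp trim_cat big_cat. Qed.

Lemma word_perm_trim u : word_perm (trim n u) = word_perm u.
Proof. by rewrite /word_perm trim_valid // valid_trim. Qed.

Lemma word_exp_trim u : word_exp (trim n u) = word_exp u.
Proof. by rewrite /word_exp trim_valid // valid_trim. Qed.

Lemma inord_eq i j : i < n -> j < n -> (@inord N i == inord j) = (i == j).
Proof. by move=> iN jN; rewrite -val_eqE /= !inordK. Qed.

Lemma word_perm_beq u v : beq n u v -> word_perm u = word_perm v.
Proof.
elim=> {u v} [//|//|u v w _ -> _ -> //|x u v y _ E|i b ib|i j ii jj ij|i i0 i1].
- by rewrite !word_permM E.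
- by rewrite /word_perm /= ib !big_cons big_nil mulg1 /letter_perm /= tperm2.
- rewrite /word_perm /= ii jj !big_cons !big_nil !mulg1 /letter_perm /=.
  by apply/permP => x; apply/val_inj; rewrite !permM /= !tperm_valE /= !inordK;
    do ?case: ifP; plia.
rewrite /word_perm /= i0 i1 (ltnW i1) /= !big_cons !big_nil !mulg1 /letter_perm /=.
by apply/permP => x; apply/val_inj; rewrite !permM /= !tperm_valE /= !inordK;
  do ?case: ifP; plia.
Qed.

Lemma word_exp_beq u v : beq n u v -> word_exp u = word_exp v.
Proof.
elim=> {u v} [//|//|u v w _ -> _ -> //|x u v y _ E|i b ib|i j ii jj ij|i i0 i1].
- by rewrite !word_expM E.
- by rewrite /word_exp /= ib !big_cons big_nil; case: b.
- by rewrite /word_exp /= ii jj !big_cons.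
- by rewrite /word_exp /= i0 i1 (ltnW i1) /= !big_cons !big_nil.
Qed.

Definition braid_perm (g : B) : 'S_n := word_perm (rep g).
Definition braid_exp (g : B) : int := word_exp (rep g).

Lemma braid_perm_br u : braid_perm (br n u) = word_perm u.
Proof.
by rewrite /braid_perm -word_perm_trim -[RHS]word_perm_trim; apply: word_perm_beq; exact: rep_br.
Qed.

Lemma braid_exp_br u : braid_exp (br n u) = word_exp u.
Proof.
by rewrite /braid_exp -word_exp_trim -[RHS]word_exp_trim; apply: word_exp_beq; exact: rep_br.
Qed.

Lemma braid_permM (g h : B) : braid_perm (g * h) = braid_perm g * braid_perm h.
Proof. by rewrite -(br_repK g) -(br_repK h) -brM !braid_perm_br word_permM. Qed.

Lemma braid_expM (g h : B) : braid_exp (g * h) = (braid_exp g + braid_exp h)%R.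
Proof. by rewrite -(br_repK g) -(br_repK h) -brM !braid_exp_br word_expM. Qed.

Lemma braid_perm1 : braid_perm 1 = 1.
Proof. by rewrite -br1 braid_perm_br /word_perm big_nil. Qed.

Lemma braid_exp1 : braid_exp 1 = 0%R.
Proof. by rewrite -br1 braid_exp_br /word_exp big_nil. Qed.

Lemma braid_permV (g : B) : braid_perm g^-1 = (braid_perm g)^-1.
Proof. by apply: (mulgI (braid_perm g)); rewrite -braid_permM !mulgV braid_perm1. Qed.

Lemma braid_expV (g : B) : braid_exp g^-1 = (- braid_exp g)%R.
Proof. by apply: (GRing.addrI (braid_exp g)); rewrite -braid_expM mulgV braid_exp1 GRing.subrr. Qed.

Lemma braid_permX (g : B) k : braid_perm (g ^+ k) = braid_perm g ^+ k.
Proof. by elim: k => [|k IH]; rewrite ?expg0 ?braid_perm1 // !expgS braid_permM IH. Qed.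

Lemma braid_expX (g : B) k : braid_exp (g ^+ k) = (braid_exp g *+ k)%R.
Proof. by elim: k => [|k IH]; rewrite ?expg0 ?braid_exp1 // expgS braid_expM IH GRing.mulrS. Qed.

Lemma braid_permJ (g h : B) : braid_perm (g ^ h) = braid_perm g ^ braid_perm h.
Proof. by rewrite /conjg !braid_permM braid_permV. Qed.

Lemma braid_expJ (g h : B) : braid_exp (g ^ h) = braid_exp g.
Proof. by rewrite /conjg !braid_expM braid_expV GRing.addrC -GRing.addrA GRing.subrr GRing.addr0. Qed.

Definition band_perm (p : nat * nat) : 'S_n := tperm (inord p.1.-1) (inord p.2.-1).

Definition is_band m (p : nat * nat) := (0 < p.2 < p.1) && (p.1 <= m).

Lemma braid_perm_sigma k : 0 < k < n -> braid_perm (sigma n k) = tperm (inord k.-1) (inord k).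
Proof. by move=> kn; rewrite braid_perm_br /word_perm /= kn big_cons big_nil mulg1. Qed.

Lemma braid_exp_sigma k : 0 < k < n -> braid_exp (sigma n k) = 1%R.
Proof. by move=> kn; rewrite braid_exp_br /word_exp /= kn big_cons big_nil. Qed.

Lemma braid_perm_band i j : is_band n (i, j) -> braid_perm (band_br n i j) = band_perm (i, j).
Proof.
rewrite /is_band /= => /andP[/andP[j0]].
elim: i => [//|i IH]; rewrite ltnS leq_eqVlt => /predU1P[<-|ji] i_n.
  by rewrite band1 braid_perm_sigma ?j0 // /band_perm /= tpermC.
rewrite bandSJ // braid_permJ braid_permV braid_perm_sigma; last by lia.
rewrite IH ?(ltnW i_n) // /band_perm /= tpermV tpermJ tpermL.
by rewrite tpermD // ?inord_eq //; lia.
Qed.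

Lemma braid_exp_band i j : is_band n (i, j) -> braid_exp (band_br n i j) = 1%R.
Proof.
rewrite /is_band /= => /andP[/andP[j0]].
elim: i => [//|i IH]; rewrite ltnS leq_eqVlt => /predU1P[<-|ji] i_n.
  by rewrite band1 braid_exp_sigma ?j0.
by rewrite bandSJ // braid_expJ IH // ltnW.
Qed.

Definition bprod (ps : seq (nat * nat)) : B := \prod_(p <- ps) band_br n p.1 p.2.
Definition rprod (ps : seq (nat * nat)) : 'S_n := \prod_(p <- ps) band_perm p.

Lemma bprod_cons p ps : bprod (p :: ps) = band_br n p.1 p.2 * bprod ps.
Proof. exact: big_cons. Qed.

Lemma rprod_cons p ps : rprod (p :: ps) = band_perm p * rprod ps.
Proof. exact: big_cons. Qed.

Lemma bprod_cat ps qs : bprod (ps ++ qs) = bprod ps * bprod qs.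
Proof. exact: big_cat. Qed.

Lemma rprod_cat ps qs : rprod (ps ++ qs) = rprod ps * rprod qs.
Proof. exact: big_cat. Qed.

Lemma braid_perm_bprod ps : all (is_band n) ps -> braid_perm (bprod ps) = rprod ps.
Proof.
elim: ps => [|[i j] ps IH] /=; first by rewrite /bprod /rprod !big_nil braid_perm1.
by move=> /andP[ij ps_ok]; rewrite bprod_cons rprod_cons braid_permM IH // braid_perm_band.
Qed.

Lemma braid_exp_bprod ps : all (is_band n) ps -> braid_exp (bprod ps) = (size ps)%:R%R.
Proof.
elim: ps => [|[i j] ps IH] /=; first by rewrite /bprod !big_nil braid_exp1.
by move=> /andP[ij ps_ok]; rewrite bprod_cons braid_expM IH // braid_exp_band // -GRing.natr1 GRing.addrC.
Qed.

Lemma abslen_band_perm_le p : abslen (band_perm p) <= 1.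
Proof. by rewrite -(mulg1 (band_perm p)) (leq_trans (abslen_tperm_le _ _ _)) ?abslen1. Qed.

Lemma abslen_rprod_le ps : abslen (rprod ps) <= size ps.
Proof.
elim: ps => [|p ps IH]; first by rewrite /rprod big_nil abslen1.
rewrite rprod_cons; apply: (leq_trans (abslenM_le _ _)).
exact: leq_add (abslen_band_perm_le p) IH.
Qed.

Lemma rprod_fix m ps (x : 'I_n) : all (is_band m) ps -> m <= n -> m <= x -> rprod ps x = x.
Proof.
move=> + mn mx; elim: ps => [|[i j] ps IH] /=; first by rewrite /rprod big_nil perm1.
rewrite /is_band /= => /andP[ij ps_ok]; rewrite rprod_cons permM tpermD ?IH //=;
  by rewrite -val_eqE /= inordK; lia.
Qed.

End Morphisms.

(** * Lifts of the divisors of c *)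

Section Lift.
Variable N : nat.
Notation n := N.+1.
Notation B := (braid n).
Notation c := (full_cycle N).

Lemma band_perm_valE i j (x : 'I_n) : is_band n (i, j) -> val (band_perm N (i, j) x) =
  if x == i.-1 :> nat then j.-1 else if x == j.-1 :> nat then i.-1 else x.
Proof. by rewrite /is_band /= => ij; rewrite tperm_valE /= !inordK //; lia. Qed.

Lemma below_interval_val (p : 'S_n) (v x : nat) : below p -> v < n -> x < n ->
  p (inord v) <= v -> p (inord v) <= x <= v ->
  p (inord v) <= p (inord x) <= v.
Proof.
move=> pc vn xn pv xv; have := @below_interval _ p (inord v) pc.
by rewrite (inordK vn) => /(_ pv (inord x)); rewrite (inordK xn) => /(_ xv).
Qed.

(* In a reduced word below c the relations not available in the dual presentation are excluded
   by below_interval: two crossing chords, or a triangle traversed in the wrong sense. *)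
Lemma band_exchange m i j x : m < n -> is_band m.+1 (i, j) -> 0 < x <= m ->
  abslen (band_perm N (i, j) * band_perm N (m.+1, x)) = 2 -> below (band_perm N (i, j) * band_perm N (m.+1, x)) ->
  exists x' q, [/\ 0 < x' <= m, is_band m q &
    band_br n i j * band_br n m.+1 x = band_br n m.+1 x' * band_br n q.1 q.2].
Proof.
move=> mn; rewrite /is_band /= => ij xm l2 gc.
have ok1 : is_band n (i, j) by rewrite /is_band /=; lia.
have ok2 : is_band n (m.+1, x) by rewrite /is_band /=; lia.
set g := _ * _ in l2 gc.
have gE (y : nat) : y < n -> val (g (inord y)) =
    let z := if y == i.-1 then j.-1 else if y == j.-1 then i.-1 else y in
    if z == m then x.-1 else if z == x.-1 then m else z.
  by move=> yn; rewrite permM (band_perm_valE _ ok2) (band_perm_valE _ ok1) inordK.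
have bad v y : v < n -> y < n -> val (g (inord v)) <= v -> val (g (inord v)) <= y <= v ->
    ~~ (val (g (inord v)) <= val (g (inord y)) <= v) -> False.
  by move=> vn yn H1 H2 /negP[]; exact: below_interval_val.
have [im|im] := ltnP i m.+1.
  case: (ltngtP x j) => xj.
  - exists x, (i, j); split; rewrite /is_band //=; first by lia.
    by rewrite (@band_nested n i j m.+1 x) //; lia.
  - case: (ltngtP x i) => xi.
    + case: (bad i.-1 x.-1); rewrite ?gE; try lia; move=> /=; do ?case: ifP; lia.
    + exists x, (i, j); split; rewrite /is_band //=; first by lia.
      by rewrite (@band_separated n i j m.+1 x) //; lia.
    + case: (bad m i.-1); rewrite ?gE; try lia; move=> /=; do ?case: ifP; lia.
  - exists i, (i, j); split; rewrite /is_band //=; try lia.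
    by rewrite xj (@band_chain_r n m.+1 i j) //; lia.
have iE : i = m.+1 by lia.
subst i; case: (ltngtP j x) => xj.
- exists x, (x, j); split; rewrite /is_band //=; try lia.
  by rewrite band_chain_l //; lia.
- case: (bad m j.-1); rewrite ?gE; try lia; move=> /=; do ?case: ifP; lia.
- by move: l2; rewrite /g xj /band_perm tperm2 abslen1.
Qed.

(** Work from the right end: once the tail has at most one letter with the top point, at its front,
    [band_exchange] carries it past the preceding letter, or merges the two if both contain the top
    point. *)
Lemma pull_top m ps : m < n -> all (is_band m.+1) ps ->
  abslen (rprod N ps) = size ps -> below (rprod N ps) ->
  all (is_band m) ps \/ exists x qs, [/\ 0 < x <= m, all (is_band m) qs,
    bprod N ps = band_br n m.+1 x * bprod N qs,
    rprod N ps = band_perm N (m.+1, x) * rprod N qs & size ps = (size qs).+1].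
Proof.
move=> mn; elim: ps => [|[i j] ps IH] /=; first by left.
move=> /andP[ij ps_ok]; rewrite rprod_cons bprod_cons /= => l gc.
have lE : abslen (rprod N ps) = size ps /\ abslen (band_perm N (i, j)) = 1%N.
  have H1 := abslen_rprod_le N ps; have H2 := abslen_band_perm_le N (i, j).
  have H3 := abslenM_le (band_perm N (i, j)) (rprod N ps).
  have arith (x y z t : nat) : x = t.+1 -> x <= y + z -> y <= 1 -> z <= t -> z = t /\ y = 1%N by lia.
  exact: arith l H3 H2 H1.
have [l1 l2] := lE.
have red : reduced (band_perm N (i, j)) (rprod N ps) by rewrite /reduced l l1 l2.
have gc' := below_suffix red gc.
have [ps_m|[x [qs [xm qs_m E1 E2 E3]]]] := IH ps_ok l1 gc'.
  have [im|im] := leqP i m; first by left; rewrite ps_m andbT; move: ij; rewrite /is_band /= im; lia.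
  right; exists j, ps; have -> : i = m.+1 by move: ij; rewrite /is_band /=; lia.
  by split=> //; move: ij; rewrite /is_band /=; lia.
right.
have l3 : abslen (rprod N qs) <= size qs := abslen_rprod_le N qs.
have l4 := abslenM_le (band_perm N (m.+1, x)) (rprod N qs).
have l5 := abslen_band_perm_le N (m.+1, x).
have l6 := abslenM_le (band_perm N (i, j)) (band_perm N (m.+1, x)).
have l7 := abslenM_le (band_perm N (i, j) * band_perm N (m.+1, x)) (rprod N qs).
rewrite -E2 l1 E3 in l4; rewrite -mulpA -E2 l E3 in l7.
have [l8 l9] : abslen (band_perm N (i, j) * band_perm N (m.+1, x)) = 2 /\ abslen (rprod N qs) = size qs.
  have arith (a b e f q : nat) : e <= q -> q.+1 <= f + e -> f <= 1 -> a <= b + f -> b = 1%N ->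
    q.+2 <= a + e -> a = 2 /\ e = q by lia.
  exact: arith l3 l4 l5 l6 l2 l7.
have red2 : reduced (band_perm N (i, j) * band_perm N (m.+1, x)) (rprod N qs).
  by rewrite /reduced -mulpA -E2 l E3 l8 l9.
have gc2 : below (band_perm N (i, j) * band_perm N (m.+1, x)).
  by apply: (below_prefix red2); rewrite -mulpA -E2.
have [x' [q [x'm qm E]]] := band_exchange mn ij xm l8 gc2.
have qn : is_band n q by move: qm; rewrite /is_band; lia.
exists x', (q :: qs); split; rewrite ?E3 //=; first by rewrite qm.
  by rewrite E1 mulgA E bprod_cons mulgA.
have ij_n : is_band n (i, j) by move: ij; rewrite /is_band /=; lia.
have ok k : 0 < k <= m -> is_band n (m.+1, k) by rewrite /is_band /=; lia.
rewrite E2 rprod_cons !mulgA; congr (_ * _).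
move/(congr1 (@braid_perm N)): E; by rewrite !braid_permM !braid_perm_band ?ok.
Qed.

(** The permutation determines the letter pulled to the front: the top point is fixed if no letter
    contains it, and otherwise it is the image of [x - 1]. What remains are reduced words on fewer
    points. *)
Lemma bprod_unique m ps qs : m <= n -> all (is_band m) ps -> all (is_band m) qs ->
  rprod N ps = rprod N qs -> abslen (rprod N ps) = size ps -> abslen (rprod N qs) = size qs ->
  below (rprod N ps) -> bprod N ps = bprod N qs.
Proof.
elim: m ps qs => [|m IH] ps qs mn ps_ok qs_ok E lp lq gc.
  have nil0 ts : all (is_band 0) ts -> ts = [::].
    by case: ts => [//|[i j] ts]; rewrite /= /is_band /=; lia.
  by rewrite (nil0 _ ps_ok) (nil0 _ qs_ok).
have top_fixed ts : all (is_band m) ts -> rprod N ts (inord m) = inord m.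
  by move=> ts_ok; apply: (@rprod_fix _ m) => //; rewrite ?inordK // ltnW.
have top_moved x ts : 0 < x <= m -> all (is_band m) ts ->
    (band_perm N (m.+1, x) * rprod N ts) (inord x.-1) = inord m.
  by move=> xm ts_ok; rewrite permM /band_perm /= tpermR top_fixed.
have gc' : below (rprod N qs) by rewrite -E.
have contra x ts us : 0 < x <= m -> all (is_band m) ts -> all (is_band m) us ->
    rprod N ts <> band_perm N (m.+1, x) * rprod N us.
  move=> xm ts_ok us_ok Et; have := top_moved _ _ xm us_ok; rewrite -Et -(top_fixed _ ts_ok).
  by move/perm_inj/(congr1 val); rewrite /= !inordK; lia.
have [pm|[x [ps' [xm p'm E1 E2 E3]]]] := pull_top mn ps_ok lp gc;
  have [qm|[y [qs' [ym q'm F1 F2 F3]]]] := pull_top mn qs_ok lq gc'.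
- by apply: IH => //; exact: ltnW.
- by case: (contra y ps qs') => //; rewrite -F2.
- by case: (contra x qs ps') => //; rewrite -E2.
have xy : x = y.
  have := top_moved _ _ xm p'm; rewrite -E2 E F2 -(top_moved _ _ ym q'm).
  by move/perm_inj/(congr1 val); rewrite /= !inordK; lia.
rewrite -xy in F1 F2; have E' : rprod N ps' = rprod N qs'.
  by apply: (mulgI (band_perm N (m.+1, x))); rewrite -E2 -F2.
rewrite E1 F1; congr (_ * _).
have lr := abslen_band_perm_le N (m.+1, x).
have arith (a b e s' : nat) : a = s'.+1 -> a <= b + e -> b <= 1 -> e <= s' -> e = s' /\ b = 1%N by lia.
have [lp' lr1] : abslen (rprod N ps') = size ps' /\ abslen (band_perm N (m.+1, x)) = 1%N.
  rewrite E2 E3 in lp; exact: arith lp (abslenM_le _ _) lr (abslen_rprod_le _ _).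
have [lq' _] : abslen (rprod N qs') = size qs' /\ abslen (band_perm N (m.+1, x)) = 1%N.
  rewrite F2 F3 in lq; exact: arith lq (abslenM_le _ _) lr (abslen_rprod_le _ _).
apply: IH => //; first exact: ltnW.
apply: (@below_suffix _ (band_perm N (m.+1, x))); last by rewrite -E2.
by rewrite /reduced -E2 lp E3 lp' lr1.
Qed.

Definition is_band_word (w : 'S_n) ps :=
  [&& all (is_band n) ps, rprod N ps == w & size ps == abslen w].

Lemma band_word_exists w : exists ps, is_band_word w ps.
Proof.
elim/abslen_ind: w => [|x a ax la [ps /and3P[ok /eqP E /eqP l]]].
  by exists [::]; rewrite /is_band_word /rprod big_nil abslen1 /= !eqxx.
have tE (y z : 'I_n) : val y < val z -> tperm y z = band_perm N (z.+1, y.+1).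
  by move=> yz; rewrite /band_perm /= !inord_val tpermC.
have [p [p_ok pE]] : exists p, is_band n p /\ tperm x (a x) = band_perm N p.
  have [xa|xa|xa] := ltngtP (val x) (val (a x)).
  - by exists ((a x).+1, x.+1); rewrite tE // /is_band /= ltn_ord andbT.
  - by exists (x.+1, (a x).+1); rewrite tpermC tE // /is_band /= ltn_ord andbT.
  - by case/eqP: ax; exact/val_inj.
exists (p :: ps); rewrite /is_band_word /= p_ok ok rprod_cons E -pE mulpA tperm2 mul1g eqxx /=.
by rewrite l la.
Qed.

Definition band_word w := xchoose (band_word_exists w).

Lemma band_wordP w : [/\ all (is_band n) (band_word w), rprod N (band_word w) = w &
  size (band_word w) = abslen w].
Proof. by have /and3P[? /eqP ? /eqP ?] := xchooseP (band_word_exists w). Qed.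

(** Defined for every [w] through a chosen reduced word; for [w] below [c] the choice does not
    matter, by [dual_lift_unique]. *)
Definition dual_lift w : B := bprod N (band_word w).

Lemma braid_perm_lift w : braid_perm (dual_lift w) = w.
Proof. by have [ok E _] := band_wordP w; rewrite braid_perm_bprod. Qed.

Lemma braid_exp_lift w : braid_exp (dual_lift w) = (abslen w)%:R%R.
Proof. by have [ok _ <-] := band_wordP w; rewrite braid_exp_bprod. Qed.

Lemma dual_lift_unique w ps : below w -> all (is_band n) ps -> rprod N ps = w ->
  size ps = abslen w -> bprod N ps = dual_lift w.
Proof.
move=> wc ok E l; have [ok' E' l'] := band_wordP w.
by apply: (@bprod_unique n) => //; rewrite ?E ?E'.
Qed.

Lemma dual_liftM a b : reduced a b -> below (a * b) -> dual_lift (a * b) = dual_lift a * dual_lift b.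
Proof.
move=> red ab; have [oka Ea la] := band_wordP a; have [okb Eb lb] := band_wordP b.
rewrite /dual_lift -bprod_cat; apply/esym/dual_lift_unique => //.
- by rewrite all_cat oka.
- by rewrite rprod_cat Ea Eb.
- by rewrite size_cat la lb -red.
Qed.

Definition band_positive (g : B) := exists2 ps, all (is_band n) ps & g = bprod N ps.

Lemma dual_lift_positive w : band_positive (dual_lift w).
Proof. by have [ok _ _] := band_wordP w; exists (band_word w). Qed.

Lemma valid_bands ps : all (is_band n) ps -> valid n (flatten [seq band p.1 p.2 | p <- ps]).
Proof.
elim: ps => [//|p ps IH] /= /andP[pn /IH {}IH]; rewrite valid_cat IH andbT.
move: pn; rewrite /is_band /valid /band !all_cat !all_map /= => pn.
apply/and3P; split; last 1 first.
- by apply/allP => k; rewrite mem_iota /=; lia.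
- by rewrite all_rev; apply/allP => k; rewrite mem_iota /=; lia.
- by lia.
Qed.

Lemma br_bands (ps : seq (nat * nat)) : br n (flatten [seq band p.1 p.2 | p <- ps]) = bprod N ps.
Proof.
elim: ps => [|p ps IH]; first by rewrite /bprod big_nil.
by rewrite /= brM IH bprod_cons.
Qed.

Lemma positive_br w : valid n w -> positive n w <-> band_positive (br n w).
Proof.
have okE ps : all (fun p => (0 < p.2 < p.1)%N && (p.1 <= n)%N) ps = all (is_band n) ps by [].
move=> vw; split=> [[ps [ok E]]|[ps ok E]]; exists ps => //.
  by rewrite -br_bands; apply/esym/br_beq => //; exact: valid_bands.
by split=> //; apply/br_beq; rewrite ?br_bands //; exact: valid_bands.
Qed.

Lemma prec_br u v : valid n u -> valid n v -> prec n u v <-> band_positive ((br n u)^-1 * br n v).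
Proof. by move=> vu vv; rewrite /prec positive_br ?brM ?brV // valid_cat valid_winv vu. Qed.

Definition dchain m : seq (nat * nat) := [seq (k.+1, k) | k <- rev (iota 1 m.-1)].

Lemma dchainP m : 0 < m <= n -> [/\ all (is_band n) (dchain m), rprod N (dchain m) = cyc N 0 m.-1 &
  size (dchain m) = m.-1].
Proof.
case: m => [//|m] /= mn; split; last by rewrite size_map size_rev size_iota.
  by apply/allP => p /mapP[k]; rewrite mem_rev mem_iota => H ->; rewrite /is_band /=; lia.
elim: m mn => [|m IH] mn; first by rewrite cycaa /rprod big_nil.
have -> : dchain m.+2 = (m.+2, m.+1) :: dchain m.+1.
  by rewrite /dchain !succnK (_ : iota 1 m.+1 = iota 1 m ++ [:: m.+1]) ?rev_cat // -{1}(addn1 m) iotaD add1n.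
rewrite rprod_cons IH; last by lia.
by rewrite cycS // tpermC /band_perm /=.
Qed.

Lemma bprod_dchain m : bprod N (dchain m) = br n (down_chain m).
Proof.
rewrite /down_chain /dchain; elim: (rev _) => [|k l IH]; first by rewrite /bprod big_nil.
by rewrite /= bprod_cons brM IH.
Qed.

Lemma down_chain_delta m : down_chain m = delta m.
Proof.
rewrite /down_chain /delta; elim: (rev _) => [//|k l IH].
by rewrite /= IH /band subnn.
Qed.

(** Descend from [c]: dropping the largest point removes a transposition at the front, and reduced
    suffixes stay below [c]. *)
Lemma below_cyc m : m <= N -> below (cyc N 0 m).
Proof.
move=> mN; rewrite -(subKn mN); elim: (N - m)%N (leq_subr m N) => [|k IH] kN.
  by rewrite subn0; exact: below_c.
have {}IH := IH (ltnW kN).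
have E : (N - k = (N - k.+1).+1)%N by lia.
move: IH; rewrite E; set q := (N - k.+1)%N => H.
have qN : 0 <= q < N by lia.
have lt : abslen (tperm (inord q) (inord q.+1) : 'S_n) = 1%N.
  by rewrite -(mulg1 (tperm _ _)) -(cycaa N q) -cycS ?abslen_cyc; lia.
rewrite cycS // in H; apply: below_suffix (H).
by rewrite /reduced -cycS // lt !abslen_cyc; lia.
Qed.

Lemma dual_lift_cyc m : m <= N -> dual_lift (cyc N 0 m) = br n (down_chain m.+1).
Proof.
move=> mN; have [ok E l] := @dchainP m.+1 mN; rewrite -bprod_dchain.
apply/esym/dual_lift_unique => //; first exact: below_cyc.
by rewrite l abslen_cyc ?subn0.
Qed.

Definition delta_br : B := br n (delta n).
Notation dl := delta_br.

Lemma dual_lift_c : dual_lift c = dl.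
Proof. by rewrite dual_lift_cyc // down_chain_delta. Qed.

(** Both [a * (a^-1 * c)] and [(a^-1 * c) * a ^ c] are reduced products equal to [c], so both lift
    to [delta]; eliminating the lift of the shared factor leaves a conjugation by [delta]. *)
Lemma dual_liftJ a : below a -> dual_lift (a ^ c) = dual_lift a ^ dl.
Proof.
move=> ac; have ab : a * (a^-1 * c) = c by rewrite mulKVg.
have ba : a^-1 * c * a ^ c = c by rewrite /conjg !mulgA mulgK mulVg mul1g.
have E1 : dual_lift a * dual_lift (a^-1 * c) = dl.
  by rewrite -dual_liftM ?ab -?dual_lift_c //; exact: below_c.
have E2 : dual_lift (a^-1 * c) * dual_lift (a ^ c) = dl.
  rewrite -dual_liftM ?ba -?dual_lift_c //; last exact: below_c.
  have := reduced_swap ac; rewrite (_ : a ^ (a^-1 * c) = a ^ c) // conjgM.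
  by rewrite [a ^ a^-1]/conjg invgK mulgA mulgK.
have dV : dl^-1 = (dual_lift (a^-1 * c))^-1 * (dual_lift a)^-1 by rewrite -E1 invMg.
by apply: (mulgI (dual_lift (a^-1 * c))); rewrite E2 /conjg dV -mulgA mulKVg mulKg.
Qed.

Lemma dual_liftJX a k : below a -> dual_lift (a ^ (c ^+ k)) = dual_lift a ^ (dl ^+ k).
Proof.
move=> ac; elim: k => [|k IH]; first by rewrite !expg0 !conjg1.
by rewrite !expgSr !conjgM dual_liftJ ?IH //; exact: belowJ.
Qed.

Lemma braid_perm_delta : braid_perm dl = c.
Proof. by rewrite -dual_lift_c braid_perm_lift. Qed.

Lemma braid_exp_delta : braid_exp dl = N%:R%R.
Proof. by rewrite -dual_lift_c braid_exp_lift abslen_c. Qed.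

(** The exponent sums of [g] and its complement add up to [N], the length of [c]; hence both
    positive words have reduced images and [dual_lift_unique] applies. *)
Lemma simple_dual_lift (g : B) : band_positive g -> band_positive (g^-1 * dl) ->
  [/\ below (braid_perm g), g = dual_lift (braid_perm g) & braid_exp g = (abslen (braid_perm g))%:R%R].
Proof.
move=> [ps ok ->] [qs okq E]; rewrite braid_perm_bprod // braid_exp_bprod //.
have E1 : rprod N ps * rprod N qs = c.
  by rewrite -!braid_perm_bprod // -braid_permM -E mulKVg braid_perm_delta.
have E2 : (size ps + size qs = N)%N.
  by apply/eqP; rewrite -(Num.Theory.eqr_nat int) GRing.natrD -(braid_exp_bprod ok) -(braid_exp_bprod okq) -braid_exp_delta -braid_expM -E mulKVg.
have l1 := abslen_rprod_le N ps; have l2 := abslen_rprod_le N qs.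
have l3 := abslenM_le (rprod N ps) (rprod N qs); rewrite E1 abslen_c in l3.
have [l4 l5] : abslen (rprod N ps) = size ps /\ abslen (rprod N qs) = size qs.
  have arith (a b e f m : nat) : a <= b -> e <= f -> m <= a + e -> b + f = m -> a = b /\ e = f by lia.
  exact: arith l1 l2 l3 E2.
have red : reduced (rprod N ps) (rprod N qs) by rewrite /reduced E1 abslen_c l4 l5 E2.
have bp : below (rprod N ps) := reduced_below red E1.
by split=> //; [exact: dual_lift_unique | rewrite l4].
Qed.

Lemma below_simple a : below a -> band_positive (dual_lift a) /\ band_positive ((dual_lift a)^-1 * dl).
Proof.
move=> ac; split; first exact: dual_lift_positive.
have E : dual_lift a * dual_lift (a^-1 * c) = dl.
  by rewrite -dual_liftM ?mulKVg ?dual_lift_c //; exact: below_c.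
by rewrite -E mulKg; exact: dual_lift_positive.
Qed.

End Lift.

Lemma card_mod_finset (T : eqType) (A : finType) (E : T -> T -> Prop) (P : T -> Prop)
    (S : {set A}) (f : A -> T) :
  (forall a, a \in S -> P (f a)) ->
  (forall a b, a \in S -> b \in S -> E (f a) (f b) -> a = b) ->
  (forall t, P t -> exists2 a, a \in S & E t (f a)) -> card_mod E P #|S|.
Proof.
move=> fP f_inj f_surj; exists [seq f a | a <- enum S]; split; first by rewrite size_map -cardE.
split; first by move=> w /mapP[a]; rewrite mem_enum => aS ->; exact: fP.
split=> [i j x|w /f_surj[a aS wa]]; last first.
  by exists (f a) => //; apply/mapP; exists a => //; rewrite mem_enum.
rewrite size_map => iS jS ij; case: (enum S) (mem_enum S) (enum_uniq S) iS jS => [//|a0 l] aS ul iS jS.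
rewrite !(nth_map a0) // => /f_inj E'; case: ij; apply/eqP.
by rewrite -(nth_uniq a0 iS jS ul); apply/eqP/E'; rewrite -aS mem_nth.
Qed.

(** * Words representing lifts, and the powers of [epsilon] *)

Section Words.
Variable N : nat.
Notation n := N.+1.
Notation B := (braid n).
Notation c := (full_cycle N).
Notation dl := (delta_br N).
Notation dual_lift := (@dual_lift N).

Definition dual_lift_word (w : 'S_n) : word := flatten [seq band p.1 p.2 | p <- band_word w].

Lemma br_dual_lift_word w : br n (dual_lift_word w) = dual_lift w.
Proof. exact: br_bands. Qed.

Lemma valid_dual_lift_word w : valid n (dual_lift_word w).
Proof. by apply: valid_bands; have [] := band_wordP w. Qed.

Lemma valid_delta : valid n (delta n).
Proof.
rewrite /delta /valid all_map all_rev; apply/allP => k.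
by rewrite mem_iota /=; lia.
Qed.

Lemma valid_pow w k : valid n w -> valid n (flatten (nseq k w)).
Proof. by move=> vw; elim: k => [//|k IH] /=; rewrite valid_cat vw. Qed.

Lemma valid_wpow w z : valid n w -> valid n (wpow w z).
Proof. by move=> vw; case: z => k; apply: valid_pow; rewrite ?valid_winv. Qed.

Lemma br_pow w k : br n (flatten (nseq k w)) = br n w ^+ k.
Proof. by elim: k => [|k IH] //=; rewrite brM IH expgS. Qed.

Lemma br_wpow w k : br n (wpow w (Posz k)) = br n w ^+ k.
Proof. exact: br_pow. Qed.

Lemma braid_exp_wpow w z : braid_exp (br n (wpow w z)) = (z * braid_exp (br n w))%R.
Proof.
case: z => k; rewrite /wpow br_pow braid_expX; first by rewrite -GRing.mulr_natl natz.
by rewrite brV braid_expV -GRing.mulr_natl natz NegzE GRing.mulrN GRing.mulNr.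
Qed.

Lemma band_positive_exp (g : B) : band_positive g -> (Posz (abslen (braid_perm g)) <= braid_exp g)%R.
Proof.
by move=> [ps ok ->]; rewrite braid_perm_bprod // braid_exp_bprod // natz lez_nat; exact: abslen_rprod_le.
Qed.

Lemma prec_braid_exp u v : valid n u -> valid n v -> prec n u v ->
  (braid_exp (br n u) <= braid_exp (br n v))%R.
Proof.
move=> vu vv /prec_br => /(_ vu vv) /band_positive_exp; rewrite braid_expM braid_expV GRing.addrC => H.
by rewrite -Num.Theory.subr_ge0; apply: Order.POrderTheory.le_trans H.
Qed.

Lemma conj_to_br a b : valid n a -> valid n b ->
  conj_to n a b <-> exists x, br n b = br n a ^ x.
Proof.
move=> va vb; split=> [[x [vx /br_beq E]]|[x E]].
  exists (br n x); rewrite E // ?brM ?brV // ?valid_cat ?valid_winv ?vx ?va //.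
exists (trim n (rep x)); rewrite valid_trim; split=> //.
have xE : br n (trim n (rep x)) = x.
  by rewrite -[RHS]br_repK; apply/brP; rewrite trim_valid ?valid_trim //; exact: beq_refl.
by apply/br_beq; rewrite ?valid_cat ?valid_winv ?valid_trim ?va //= !brM brV xE.
Qed.

Lemma dual_lift1 : dual_lift 1 = 1.
Proof.
rewrite /dual_lift; have [_ _] := band_wordP (1 : 'S_n).
by rewrite abslen1 => /size0nil ->; rewrite /bprod big_nil.
Qed.

Lemma cyc_turn k : k < N -> cyc N 1 k.+1 * cyc N 0 1 = cyc N 0 k.+1.
Proof.
move=> kN; apply/permP => x; apply/val_inj; have xN := ltn_ord x.
rewrite permM !cycE /=; try plia.
have [h|h] := boolP (0 < x < k.+1); first by do ?case: ifP; plia.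
by have [h'|h'] := eqVneq (x : nat) k.+1; rewrite /=; do ?case: ifP; plia.
Qed.

(** Moving the lift of [cyc N 0 k] past the next [delta] shifts it to [cyc N 1 k.+1]; the new letter
    [band 2 1] then joins the point 0 to the cycle. *)
Lemma epsilon_pow k : k <= N -> br n (wpow (epsilon n) (Posz k)) = dl ^+ k * dual_lift (cyc N 0 k).
Proof.
rewrite br_wpow => kN; elim: k kN => [|k IH] kN; first by rewrite !expg0 cycaa dual_lift1 mulg1.
have E1 : br n (band 2 1) = dual_lift (cyc N 0 1).
  by rewrite dual_lift_cyc ?(leq_trans _ kN) // /down_chain /= cats0.
rewrite expgSr IH ?(ltnW kN) // /epsilon brM E1 -/dl mulgA -(mulgA _ _ dl).
have kJ : cyc N 0 k ^ c = cyc N 1 k.+1.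
  by have := @cycJ N 0 k 1 (leq0n _); rewrite expg1 addn1 add0n => ->.
have -> : dual_lift (cyc N 0 k) * dl = dl * dual_lift (cyc N 1 k.+1).
  by rewrite -kJ dual_liftJ ?mulKVg //; apply: below_cyc; exact: ltnW.
rewrite mulgA -expgSr -mulgA -dual_liftM ?cyc_turn //; last exact: below_cyc.
by rewrite /reduced cyc_turn // !abslen_cyc; lia.
Qed.

End Words.

(** * The super summit set *)

Section SuperSummitSet.
Variables (r d : nat).
Hypotheses (r_ge2 : 1 < r) (d_gt0 : 0 < d).
Notation N := (r * d)%N.
Notation n := N.+1.
Notation B := (braid n).
Notation c := (full_cycle N).
Notation dl := (delta_br N).
Notation dual_lift := (@dual_lift N).

Let dN : d < N. Proof. by nia. Qed.

Lemma periodic_below w : w \in periodic r d -> below w.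
Proof.
move=> wX; have := @below_twisted_power _ _ r_ge2 d_gt0 w 1 wX (ltnW r_ge2).
by rewrite twisted_power1.
Qed.

(** Induction on the number of windows that may be moved. A merging step is realized by conjugating
    with the lift of the shifted part, and with one window left only [cyc N 0 d] is possible. *)
Lemma based_conj w m : w \in based r d -> 0 < m <= r -> (forall x : 'I_n, m * d < x -> w x = x) ->
  exists x : B, dl ^+ d * dual_lift w = (dl ^+ d * dual_lift (cyc N 0 d)) ^ x.
Proof.
elim: m w => [//|m IH] w wB mr wx; have [m0|m_gt0] := posnP m.
  exists 1; rewrite conjg1 (based_first r_ge2 d_gt0 wB) // => x xd.
  by apply: wx; rewrite m0 mul1n.
have mr' : 0 < m < r by rewrite m_gt0.
have [a [b [wE red w'B red' w'x]]] := based_merge r_ge2 d_gt0 wB mr' wx.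
have [|x Ex] := IH _ w'B _ w'x; first by rewrite m_gt0 ltnW.
set b' := b ^ _ in w'B red' w'x Ex.
have [wX _] := basedP r_ge2 d_gt0 _ wB; have [w'X _] := basedP r_ge2 d_gt0 _ w'B.
have bb' : b = b' ^ (c ^+ d) by rewrite /b' conjgKV.
have b'c : below b' by apply: (below_suffix red'); exact: periodic_below.
have bE : dual_lift b = dual_lift b' ^ (dl ^+ d) by rewrite bb' dual_liftJX.
have wc := periodic_below wX; have w'c := periodic_below w'X.
exists (x * (dual_lift b')^-1); rewrite conjgM -Ex dual_liftM // wE dual_liftM -?wE // bE.
by rewrite /conjg invgK !mulgA mulgV mul1g mulgK.
Qed.

Lemma periodic_conj w : w \in periodic r d ->
  exists x : B, dl ^+ d * dual_lift w = (dl ^+ d * dual_lift (cyc N 0 d)) ^ x.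
Proof.
move=> wX; have [j wB] := periodic_based r_ge2 d_gt0 wX.
have [|x xN|x E] := @based_conj _ r wB; first by rewrite leqnn ltnW.
  by have := ltn_ord x; rewrite ltnS leqNgt xN.
exists (x * (dl ^+ j)^-1); rewrite conjgM -E dual_liftJX; last exact: periodic_below.
have {2}-> : dl ^+ d = (dl ^+ d) ^ (dl ^+ j).
  by rewrite /conjg -expgD addnC expgD mulKg.
by rewrite -conjMg conjgK.
Qed.

(** The exponent sum of [epsilon ^ d] is [d * N + d]. As [0 < d < N], it lies strictly between those
    of [delta ^ d] and [delta ^ (d + 1)], which bounds inf and sup of every conjugate. *)
Lemma mulN_le (z : int) : (z * Posz N <= Posz (d * N + d))%R -> (z <= Posz d)%R.
Proof. by move=> H; rewrite leNgt; apply/negP => dz; nia. Qed.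

Lemma mulN_ge (z : int) : (Posz (d * N + d) <= z * Posz N)%R -> (Posz d.+1 <= z)%R.
Proof. by move=> H; rewrite leNgt; apply/negP => dz; nia. Qed.

Lemma braid_exp_periodic w : w \in periodic r d -> braid_exp (dl ^+ d * dual_lift w) = Posz (d * N + d).
Proof.
by move=> /periodicP[wd _]; rewrite braid_expM braid_expX braid_exp_lift braid_exp_delta wd -GRing.mulrnA -GRing.natrD natz mulnC.
Qed.

Lemma braid_exp_delta_pow z : braid_exp (br n (wpow (delta n) z)) = (z * Posz N)%R.
Proof. by rewrite braid_exp_wpow -/dl braid_exp_delta natz. Qed.

Lemma delta_bounds b s z : valid n b -> braid_exp (br n b) = Posz (d * N + d) ->
  is_inf n b s -> is_sup n b z -> (s <= Posz d)%R /\ (Posz d.+1 <= z)%R.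
Proof.
move=> vb eb [H1 _] [H2 _]; have vd s := valid_wpow s (valid_delta N).
have := prec_braid_exp (vd _) vb H1; have := prec_braid_exp vb (vd _) H2.
by rewrite eb !braid_exp_delta_pow => /mulN_ge ? /mulN_le.
Qed.

Lemma periodic_len b w : valid n b -> w \in periodic r d -> br n b = dl ^+ d * dual_lift w ->
  has_len n b 1%R.
Proof.
move=> vb wX bE; have eb : braid_exp (br n b) = Posz (d * N + d) by rewrite bE braid_exp_periodic.
have vd s := valid_wpow s (valid_delta N).
have [p1 p2] := below_simple (periodic_below wX).
exists (Posz d), (Posz d.+1); split; [split|split; [split|]].
- by apply/prec_br => //; rewrite br_wpow -/dl bE mulKg.
- move=> s H; have := prec_braid_exp (vd s) vb H; rewrite eb braid_exp_delta_pow; exact: mulN_le.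
- by apply/prec_br => //; rewrite br_wpow -/dl bE invMg -mulgA expgSr mulKg.
- move=> s H; have := prec_braid_exp vb (vd s) H; rewrite eb braid_exp_delta_pow; exact: mulN_ge.
- by lia.
Qed.

Lemma valid_epsilon_pow : valid n (wpow (epsilon n) (Posz d)).
Proof.
apply: valid_wpow; rewrite /epsilon valid_cat valid_delta /=; have := dN; lia.
Qed.

Lemma SSS_epsilon b : SSS n (wpow (epsilon n) (Posz d)) b <->
  valid n b /\ exists2 w, w \in periodic r d & br n b = dl ^+ d * dual_lift w.
Proof.
have eE := @epsilon_pow N d (ltnW dN); have ve := valid_epsilon_pow.
have cX : cyc N 0 d \in periodic r d by have [] := basedP r_ge2 d_gt0 _ (based_cyc r_ge2 d_gt0).
have conj_expo b' : valid n b' -> conj_to n (wpow (epsilon n) (Posz d)) b' ->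
    braid_exp (br n b') = Posz (d * N + d).
  by move=> vb /conj_to_br => /(_ ve vb)[x ->]; rewrite braid_expJ eE braid_exp_periodic.
split=> [[vb [bc [l [lb lmin]]]]|[vb [w wX bE]]]; last first.
  split=> //; split.
    by apply/conj_to_br => //; rewrite eE bE; exact: periodic_conj.
  exists 1%R; split; first exact: periodic_len wX bE.
  move=> b' l' vb' b'c [s [z [H1 [H2 ->]]]].
  have [] := delta_bounds vb' (conj_expo _ vb' b'c) H1 H2; lia.
(* The word for [epsilon ^ d] itself has length 1, so the minimal length is at most 1; with the
   bounds this forces inf [d] and sup [d + 1]. *)
split=> //; have l1 : (l <= 1)%R.
  apply: (lmin _ _ ve _ (periodic_len ve cX eE)).
  by apply/(conj_to_br ve ve); exists 1; rewrite conjg1.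
have eb := conj_expo _ vb bc.
have [s [z [H1 [H2 lE]]]] := lb.
have [sd zd] := delta_bounds vb eb H1 H2.
have sE : s = Posz d by lia.
have zE : z = Posz d.+1 by lia.
have vd s' := valid_wpow s' (valid_delta N).
case: H1 H2 => [H1 _] [H2 _]; rewrite sE in H1; rewrite zE in H2.
move/prec_br: H1 => /(_ (vd _) vb); move/prec_br: H2 => /(_ vb (vd _)).
rewrite !br_wpow -/dl; set g := (dl ^+ d)^-1 * br n b => p1 p2.
have bg : br n b = dl ^+ d * g by rewrite /g mulKVg.
have p3 : band_positive (g^-1 * dl) by move: p1; rewrite bg invMg -mulgA expgSr mulKg.
have [gc gE ge] := simple_dual_lift p2 p3.
exists (braid_perm g); last by rewrite -gE.
apply/periodicP; split.
  apply/eqP; rewrite -eqz_nat -natz -ge; move: eb; rewrite bg braid_expM braid_expX braid_exp_delta natz.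
  by rewrite -GRing.mulr_natl natz; lia.
(* The condition on the [r]-th power is invariant under conjugation, so it is inherited from
   [epsilon ^ d]. *)
have [x xE] : exists x, br n b = br n (wpow (epsilon n) (Posz d)) ^ x by apply/conj_to_br.
have phid : c ^+ d * braid_perm g = braid_perm (br n b) by rewrite [in RHS]bg [RHS]braid_permM braid_permX braid_perm_delta.
rewrite phid xE braid_permJ -conjXg eE braid_permM braid_permX braid_perm_delta braid_perm_lift.
by have [_ ->] := periodicP _ cX; rewrite conj1g.
Qed.

Lemma card_SSS : card_mod (beq n) (SSS n (wpow (epsilon n) (Posz d))) #|periodic r d|.
Proof.
pose f (w : 'S_n) := wpow (delta n) (Posz d) ++ dual_lift_word w.
have vf w : valid n (f w).
  by rewrite valid_cat valid_dual_lift_word valid_wpow // valid_delta.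
have fE w : br n (f w) = dl ^+ d * dual_lift w by rewrite brM br_wpow br_dual_lift_word.
apply: (@card_mod_finset _ _ _ _ _ f) => [w wX|w w' _ _ E|b /SSS_epsilon[vb [w wX bE]]].
- by apply/SSS_epsilon; split=> //; exists w.
- move/br_beq: E => /(_ (vf w) (vf w')); rewrite !fE => /mulgI /(congr1 (@braid_perm N)).
  by rewrite !braid_perm_lift.
- by exists w => //; apply/br_beq; rewrite ?fE.
Qed.

End SuperSummitSet.

(** * Multichains *)

Section Multichains.
Variables (N r d : nat).
Hypotheses (r_gt0 : 0 < r) (d_gt0 : 0 < d) (dN : d <= N).
Notation n := N.+1.
Notation B := (braid n).
Notation dual_lift := (@dual_lift N).
Notation C := (cyc N 0 d.-1).
Implicit Types (s : {ffun 'I_r -> 'S_n}) (t : seq word).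

Let d1N : d.-1 <= N. Proof. by lia. Qed.

Definition factor s i : 'S_n := if insub i is Some j then s j else 1.

Definition prefix s k : 'S_n := \prod_(0 <= i < k) factor s i.

Lemma factorE s (j : 'I_r) : factor s j = s j. Proof. by rewrite /factor valK. Qed.

Lemma prefixS s k : prefix s k.+1 = prefix s k * factor s k.
Proof. by rewrite /prefix big_nat_recr. Qed.

Lemma prefix0 s : prefix s 0 = 1. Proof. by rewrite /prefix big_nil. Qed.

Lemma prefix_all s : prefix s r = \prod_j s j.
Proof. by rewrite /prefix big_mkord; apply: eq_bigr => j _; rewrite factorE. Qed.

(** The lengths of all factors add up to that of the product, so no length is lost in a partial
    product or in its remainder. *)
Lemma reduced_prefixS s k : s \in minfact r C -> k < r -> reduced (prefix s k) (factor s k) /\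
  below (prefix s k.+1).
Proof.
move=> sF kr; have [sp sl] := minfactP _ _ sF.
pose L i j := (\sum_(i <= m < j) abslen (factor s m))%N.
have Lr : L 0 r = abslen C.
  by rewrite -sl /L big_mkord; apply: eq_bigr => j _; rewrite factorE.
have LE i : i <= r -> abslen (prefix s i) = L 0 i /\ below (prefix s i).
  move=> ir; pose rest := \prod_(i <= m < r) factor s m.
  have E : prefix s i * rest = C by rewrite -sp -prefix_all /prefix [RHS](big_cat_nat (leq0n i) ir).
  have H1 := abslen_prod_le (index_iota 0 i) (factor s).
  have H2 := abslen_prod_le (index_iota i r) (factor s).
  have H3 := abslenM_le (prefix s i) rest.
  have H4 : L 0 r = (L 0 i + L i r)%N by rewrite /L (big_cat_nat (leq0n i) ir).
  rewrite -/(prefix s i) -/(L 0 i) in H1; rewrite -/rest -/(L i r) in H2.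
  rewrite E -Lr H4 in H3.
  have H5 : abslen (prefix s i) = L 0 i /\ abslen rest = L i r by lia.
  split; first by case: H5.
  apply: (@below_prefix _ _ rest); last by rewrite E; exact: below_cyc.
  by rewrite /reduced E -Lr H4; case: H5 => -> ->.
have [E1 _] := LE k (ltnW kr); have [E2 b2] := LE k.+1 kr; split=> //.
by rewrite /reduced -prefixS E2 E1 /L big_nat_recr.
Qed.

(** Only the proper partial products are listed; the full product is the top of the chain. *)
Definition chain_of s : seq word := mkseq (fun k => dual_lift_word (prefix s k.+1)) r.-1.

Lemma valid_down_chain m : 0 < m <= n -> valid n (down_chain m).
Proof.
by move=> mn; have [ok _ _] := @dchainP N m mn; have := valid_bands ok; rewrite /dchain -map_comp.
Qed.

Lemma chain_ofE s k : s \in minfact r C -> k <= r ->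
  br n (nth [::] ([::] :: rcons (chain_of s) (down_chain d)) k) = dual_lift (prefix s k) /\
  valid n (nth [::] ([::] :: rcons (chain_of s) (down_chain d)) k).
Proof.
move=> sF; case: k => [|k] kr /=; first by rewrite prefix0 dual_lift1.
rewrite nth_rcons size_mkseq; have [kr'|rk] := ltnP k r.-1.
  by rewrite nth_mkseq // br_dual_lift_word valid_dual_lift_word.
have -> : k = r.-1 by lia.
rewrite eqxx prednK // prefix_all; have [-> _] := minfactP _ _ sF.
by rewrite dual_lift_cyc // prednK // valid_down_chain //; lia.
Qed.

Lemma multichain_chain_of s : s \in minfact r C -> multichain n r.-1 (down_chain d) (chain_of s).
Proof.
move=> sF; split; first exact: size_mkseq.
split; first by apply/allP => w /mapP[k _ ->]; exact: valid_dual_lift_word.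
split=> [k kr|c k kr].
  rewrite nth_mkseq //; have [_ bk] := reduced_prefixS sF (leq_trans kr (leq_pred r)).
  have [p1 p2] := below_simple bk.
  have vl := valid_dual_lift_word (prefix s k.+1).
  by split; apply/prec_br; rewrite ?valid_delta // br_dual_lift_word // br1 invg1 mul1g.
have kr' : k < r by lia.
have [E1 v1] := chain_ofE sF (ltnW kr'); have [E2 v2] := chain_ofE sF kr'.
apply/prec_br => //; rewrite E1 E2.
have [red bk] := reduced_prefixS sF kr'.
by rewrite prefixS dual_liftM -?prefixS // mulKg; exact: dual_lift_positive.
Qed.

Lemma chain_of_inj s s' : s \in minfact r C -> s' \in minfact r C ->
  seq_beq n (chain_of s) (chain_of s') -> s = s'.
Proof.
move=> sF s'F [_]; rewrite size_mkseq => E.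
have pE k : k <= r -> prefix s k = prefix s' k.
  case: k => [|k] kr; first by rewrite !prefix0.
  have [kr'|rk] := ltnP k r.-1; last first.
    have -> : k.+1 = r by lia.
    by rewrite !prefix_all; have [-> _] := minfactP _ _ sF; have [-> _] := minfactP _ _ s'F.
  have := E k kr'; rewrite !nth_mkseq // => /br_beq => /(_ (valid_dual_lift_word _) (valid_dual_lift_word _)).
  by rewrite !br_dual_lift_word => /(congr1 (@braid_perm N)); rewrite !braid_perm_lift.
apply/ffunP => j; rewrite -!factorE; apply: (mulgI (prefix s j)).
by rewrite -prefixS pE // prefixS pE // ltnW.
Qed.

(** The factors are the images of the quotients of consecutive entries. The quotients are positive,
    so the lengths are bounded by differences of exponent sums, which telescope to the length of
    [C]; hence the factorization is reduced. *)
Lemma chain_of_surj t : multichain n r.-1 (down_chain d) t ->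
  exists2 s, s \in minfact r C & seq_beq n t (chain_of s).
Proof.
move=> [tr [/allP tv [ts tc]]].
pose u k := nth [::] ([::] :: rcons t (down_chain d)) k.
have uE k : k < r.-1 -> u k.+1 = nth [::] t k by move=> kr; rewrite /u /= nth_rcons tr kr.
have ur : u r = down_chain d by rewrite /u -(prednK r_gt0) /= nth_rcons tr ltnn eqxx.
have uv k : k <= r -> valid n (u k).
  case: k => [//|k] kr; have [kr'|rk] := ltnP k r.-1.
    by rewrite uE //; apply: tv; rewrite mem_nth // tr.
  by rewrite (_ : k.+1 = r) ?ur ?valid_down_chain //; lia.
have ul k : k <= r -> br n (u k) = dual_lift (braid_perm (br n (u k))).
  case: k => [|k] kr; first by rewrite /u /= br1 braid_perm1 dual_lift1.
  have [kr'|rk] := ltnP k r.-1; last first.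
    have -> : k.+1 = r by lia.
    by rewrite ur -{2}(prednK d_gt0) -dual_lift_cyc // braid_perm_lift dual_lift_cyc // prednK.
  have [p1 p2] := ts k kr'; rewrite -uE // in p1 p2.
  move/prec_br: p1 => /(_ isT (uv _ kr)); rewrite br1 invg1 mul1g => p1.
  move/prec_br: p2 => /(_ (uv _ kr) (valid_delta N)) p2.
  by have [] := simple_dual_lift p1 p2.
pose a k := braid_perm (br n (u k)).
pose s : {ffun 'I_r -> 'S_n} := [ffun j : 'I_r => (a j)^-1 * a j.+1].
have sa k : k <= r -> prefix s k = a k.
  elim: k => [|k IH] kr; first by rewrite prefix0 /a /u /= br1 braid_perm1.
  rewrite prefixS IH ?(ltnW kr) // (factorE s (Ordinal kr)) ffunE /= mulKVg //.
have aC : a r = C by rewrite /a ur -(prednK d_gt0) -dual_lift_cyc // braid_perm_lift.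
have sP : \prod_j s j = C by rewrite -prefix_all sa.
pose e k := braid_exp (br n (u k)).
have se (j : 'I_r) : (Posz (abslen (s j)) <= e j.+1 - e j)%R.
  have jr := ltn_ord j; have := tc j; rewrite -ltnS prednK // => /(_ jr) /prec_br.
  move=> /(_ (uv _ (ltnW jr)) (uv _ jr)) /band_positive_exp.
  by rewrite braid_permM braid_permV braid_expM braid_expV GRing.addrC ffunE.
have esum k : k <= r -> (Posz (\sum_(0 <= i < k) abslen (factor s i))%N <= e k)%R.
  elim: k => [|k IH] kr; first by rewrite big_nil /e /u /= br1 braid_exp1.
  rewrite big_nat_recr //= (factorE s (Ordinal kr)).
  have := se (Ordinal kr); have := IH (ltnW kr); rewrite /= PoszD.
  by set x := Posz _; set y := Posz _; lia.
exists s.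
  rewrite in_minfact sP eqxx /= -lez_nat.
  have := esum r (leqnn r).
  rewrite (_ : e r = Posz (abslen C)); last first.
    by rewrite /e ur -(prednK d_gt0) -dual_lift_cyc // braid_exp_lift natz.
  rewrite (_ : (\sum_(0 <= i < r) abslen (factor s i) = \sum_j abslen (s j))%N) //.
  by rewrite big_mkord; apply: eq_bigr => j _; rewrite factorE.
split=> [|k]; rewrite ?size_mkseq // tr => kr.
have kr' : k.+1 <= r by lia.
apply/br_beq; rewrite -?uE ?nth_mkseq ?valid_dual_lift_word ?uv // br_dual_lift_word sa //.
exact: ul.
Qed.

Lemma card_multichain : card_mod (seq_beq n) (multichain n r.-1 (down_chain d)) #|minfact r C|.
Proof.
apply: (@card_mod_finset _ _ _ _ _ chain_of).
- exact: multichain_chain_of.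
- exact: chain_of_inj.
- exact: chain_of_surj.
Qed.

End Multichains.

Close Scope group_scope.

Theorem theorem3p4 (n r d : nat) :
  (2 <= r)%N -> (1 <= d)%N -> n = (r * d).+1 ->
  exists Z : nat,
    card_mod (seq_beq n) (multichain n r.-1 (down_chain d)) Z /\
    card_mod (beq n) (SSS n (wpow (epsilon n) (Posz d))) (n * Z) /\
    d * Z = 'C(n.-1, d.-1).
Proof.
move=> r_ge2 d_gt0 ->; have r_gt0 : 0 < r := ltnW r_ge2.
have dN : d <= r * d by rewrite leq_pmull.
exists #|minfact r (cyc (r * d) 0 d.-1)|; split; first exact: card_multichain.
split.
  (* The windows use [cyc N 1 d] and the top of the chain uses [cyc N 0 d.-1]: cycles on equally
     many consecutive points, with equally many factorizations. *)
  rewrite (_ : #|minfact r (cyc (r * d) 0 d.-1)| = #|based r d|).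
    by rewrite -card_periodic //; exact: card_SSS.
  rewrite card_based // !card_minfact_cyc ?subn0 ?subn1 //; lia.
rewrite card_minfact_cyc ?subn0 ?prednK //; last by lia.
by apply: card_minfact_cycle => //; rewrite d_gt0.
Qed.
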